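(* Let $\sigma\ge0$ and $\gamma>0$ be fixed and set $V=\sqrt{1+\sigma}$. For small $\varepsilon>0$ let $(n^\varepsilon,u^\varepsilon,\phi^\varepsilon)$ be the solitary wave solution (defined in the context) and define \[ n_R^\varepsilon=n^\varepsilon-1-\varepsilon n_{\mathrm{KdV}},\qquad u_R^\varepsilon=u^\varepsilon-\varepsilon Vn_{\mathrm{KdV}},\qquad \phi_R^\varepsilon=\phi^\varepsilon-\varepsilon n_{\mathrm{KdV}}, \] where $n_{\mathrm{KdV}}(\xi)=\frac{3\gamma}{V}\operatorname{sech}^2\!\big(\sqrt{V\gamma/2}\,\xi\big)$. Then there exist positive constants $\varepsilon_1$ and $\alpha$, and for every non-negative integer $k$ a constant $C_k>0$, with $\varepsilon_1,\alpha$ independent of $k$ and all of them independent of $\varepsilon$, such that for all $0<\varepsilon<\varepsilon_1$, \[ \sup_{\xi\in\mathbb{R}}\Big| e^{\alpha|\xi|/2}\big((n_R^\varepsilon)^{(k)},(u_R^\varepsilon)^{(k)},(\phi_R^\varepsilon)^{(k)}\big)(\xi)\Big|\le C_k\varepsilon^2, \] where $f^{(k)}$ denotes the $k$-th derivative in $\xi$.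
   Context: For $\varepsilon>0$, consider the system in $\xi\in\mathbb{R}$: $-(V+\gamma\varepsilon)n'+(nu)'=0$, $-(V+\gamma\varepsilon)u'+uu'+\sigma n'/n=-\phi'$, $\varepsilon\phi''=e^\phi-n$, with $n\to1,u\to0,\phi\to0$ as $|\xi|\to\infty$. With $V=\sqrt{1+\sigma}$, for all sufficiently small $\varepsilon>0$ this system has a non-trivial smooth solution, unique up to translation; the ''solitary wave solution'' $(n^\varepsilon,u^\varepsilon,\phi^\varepsilon)$ is the translate that is even in $\xi$ and satisfies $(n^\varepsilon)',(u^\varepsilon)',(\phi^\varepsilon)'<0$ on $(0,\infty)$ (so its maximum is attained at $\xi=0$, and $n^\varepsilon>1$, $u^\varepsilon>0$, $\phi^\varepsilon>0$). The function $n_{\mathrm{KdV}}$ is the solitary wave of the KdV equation $\partial_{\bar t}v+Vv\partial_{\bar x}v+\frac{1}{2V}\partial_{\bar x}^3v=0$ with speed $\gamma$. *)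

(* Defs.v *)
From Stdlib Require Import Reals.
From Coquelicot Require Import Coquelicot.
Open Scope R_scope.

Definition sech (x : R) : R := / cosh x.

Definition Vspeed (sigma : R) : R := sqrt (1 + sigma).

Definition n_KdV (sigma gamma : R) (xi : R) : R :=
  3 * gamma / Vspeed sigma * (sech (sqrt (Vspeed sigma * gamma / 2) * xi)) ^ 2.

Definition smooth (f : R -> R) : Prop := forall (k : nat) (x : R), ex_derive_n f k x.

(* (n, u, phi) is the solitary wave solution of the Euler-Poisson travelling-wave
   system with parameters sigma, gamma, eps, and V = sqrt(1+sigma):
   smooth, solves the ODE system on R, decays to (1,0,0) at +-oo,
   is even, and has strictly negative derivatives on (0, +oo). *)
Definition solitary_wave (sigma gamma eps : R) (n u phi : R -> R) : Prop :=
  let c := Vspeed sigma + gamma * eps in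
  smooth n /\ smooth u /\ smooth phi /\
  (forall xi, - c * Derive n xi + Derive (fun x => n x * u x) xi = 0) /\
  (forall xi, - c * Derive u xi + u xi * Derive u xi + sigma * Derive n xi / n xi
              = - Derive phi xi) /\
  (forall xi, eps * Derive_n phi 2 xi = exp (phi xi) - n xi) /\
  is_lim n p_infty 1 /\ is_lim n m_infty 1 /\
  is_lim u p_infty 0 /\ is_lim u m_infty 0 /\
  is_lim phi p_infty 0 /\ is_lim phi m_infty 0 /\
  (forall xi, n (- xi) = n xi) /\ (forall xi, u (- xi) = u xi) /\
  (forall xi, phi (- xi) = phi xi) /\
  (forall xi, 0 < xi -> Derive n xi < 0 /\ Derive u xi < 0 /\ Derive phi xi < 0).

Definition n_R (sigma gamma eps : R) (n : R -> R) (xi : R) : R :=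
  n xi - 1 - eps * n_KdV sigma gamma xi.
Definition u_R (sigma gamma eps : R) (u : R -> R) (xi : R) : R :=
  u xi - eps * Vspeed sigma * n_KdV sigma gamma xi.
Definition phi_R (sigma gamma eps : R) (phi : R -> R) (xi : R) : R :=
  phi xi - eps * n_KdV sigma gamma xi.

(* Main.v *)
(** The flow equations give u and phi as functions of n, so with n = 1 + eps M and
    phi = eps W the wave satisfies W'' = a0 W - V^2 W^2 + eps err, a0 = 2 V gamma.
    Every Taylor remainder involved has a derivative of the form W' times a bounded
    quantity and vanishes at infinity; as W is monotone on (0,+oo), it is therefore
    O(W).  In particular |err| <= C W, and integrating W'' W' gives
    W'^2 = a0 W^2 - (2/3) V^2 W^3 + O(eps W^2), which also shows that M cannot exceed
    a fixed multiple of the KdV amplitude.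

    The comparison with KdV is made on Z = 1/W, for which the limiting equation
    Z'' = a0 Z - V^2/3 is linear: Z minus the reciprocal KdV profile is
    O(eps exp(lam xi)) with lam slightly above kap = sqrt a0, and multiplying by W and
    by the profile, which decay like exp(-kap xi/2) and exp(-kap xi), gives
    W - n_KdV = O(eps exp(-kap xi/4)).

    Finally, the rescaled quantities form a closed polynomial differential system, so
    pointwise bounds on them pass to all derivatives; the same holds for
    Delta = (W - n_KdV)/eps, because Delta'' = a0 Delta - V^2 (W + n_KdV) Delta + err.
    The three remainders are eps^2 times polynomials in these quantities. *)

Require Import Defs.
From Stdlib Require Import Reals Lra Lia Psatz IndefiniteDescription.
From Coquelicot Require Import Coquelicot.
Open Scope R_scope.

(** * Calculus on a half-line *)

(** Comparing [W] with the KdV profile [v] directly meets a linearised operator with variable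
    coefficients whose kernel contains [v']. For [Z = 1/W], inserting the first integral into
    [Z'' = - W'' Z^2 + 2 W'^2 Z^3] leaves a constant-coefficient equation; its two free data are
    pinned at the crest, where evenness gives [Z' = 0] and the first integral gives [Z 0]. The price
    is that differences of reciprocals grow, so rates have to be tracked: growth [9/8 kap], strictly
    above [kap] to avoid resonance, against decay [kap/2] for [W] (a crude but cheap rate) and [kap]
    for [v]. The sum 9/8 - 1/2 - 1 = -3/8 leaves room for the rate [kap/4].

    Nothing is known beforehand about the amplitude of a wave as [eps] tends to 0. The bounds are
    therefore first proved on the region [M <= K1], a neighbourhood of infinity in the half-line,
    and the first integral then shows that this region is the whole half-line. Uniformity in [eps]
    is obtained by treating a wave together with its [eps] as an index: every constant is chosen
    before the index. *)

Lemma is_derive_continuity_pt (f : R -> R) (x l : R) :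
  is_derive f x l -> continuity_pt f x.
Proof.
  intros H. apply continuity_pt_filterlim.
  apply (ex_derive_continuous f x). now exists l.
Qed.

Lemma is_derive_eq (f : R -> R) (x l l' : R) :
  is_derive f x l -> l = l' -> is_derive f x l'.
Proof. now intros H <-. Qed.

Lemma is_derive_congr (f g : R -> R) (x l : R) :
  (forall t, f t = g t) -> is_derive f x l -> is_derive g x l.
Proof. intros E. now apply is_derive_ext. Qed.

Lemma mean_value (f df : R -> R) (a b : R) :
  a <= b -> (forall x, a <= x <= b -> is_derive f x (df x)) ->
  exists c, a <= c <= b /\ f b - f a = df c * (b - a).
Proof.
  intros Hab Hd.
  destruct (MVT_gen f a b df) as [c [Hc E]].
  - rewrite Rmin_left, Rmax_right by lra. intros x Hx. apply Hd; lra.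
  - rewrite Rmin_left, Rmax_right by lra. intros x Hx.
    apply is_derive_continuity_pt with (df x). apply Hd; lra.
  - rewrite Rmin_left, Rmax_right in Hc by lra. now exists c.
Qed.

Lemma derive_nonneg_le (f df : R -> R) (a b : R) :
  a <= b -> (forall x, a <= x <= b -> is_derive f x (df x)) ->
  (forall x, a <= x <= b -> 0 <= df x) -> f a <= f b.
Proof.
  intros Hab Hd Hp.
  destruct (mean_value f df a b Hab Hd) as [c [Hc E]].
  specialize (Hp c Hc). nra.
Qed.

Lemma is_lim_p_infty_ball (f : R -> R) (l : R) :
  is_lim f p_infty l <->
  (forall e, 0 < e -> exists M, forall x, M < x -> Rabs (f x - l) < e).
Proof.
  split.
  - intros H e He. apply is_lim_spec in H.
    destruct (H (mkposreal e He)) as [M HM]. exists M. exact HM.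
  - intros H. apply is_lim_spec. intros e.
    destruct (H e (cond_pos e)) as [M HM]. exists M. exact HM.
Qed.

Lemma is_lim_comp_continuous_at (f g : R -> R) (l : R) :
  is_lim f p_infty l -> continuous g l -> is_lim (fun x => g (f x)) p_infty (g l).
Proof. intros Hf Hg. exact (filterlim_comp _ _ _ _ _ _ _ _ Hf Hg). Qed.

Lemma nondecreasing_lim_zero_le (f df : R -> R) (a : R) :
  (forall x, a <= x -> is_derive f x (df x)) ->
  (forall x, a <= x -> 0 <= df x) ->
  is_lim f p_infty 0 -> forall x, a <= x -> f x <= 0.
Proof.
  intros Hd Hp Hl x Hx.
  destruct (Rle_or_lt (f x) 0) as [H|H]; trivial. exfalso.
  destruct (proj1 (is_lim_p_infty_ball f 0) Hl (f x) H) as [M HM].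
  set (t := Rmax (M + 1) x).
  assert (Ht1 : M < t) by (unfold t; generalize (Rmax_l (M + 1) x); lra).
  assert (Ht2 : x <= t) by apply Rmax_r.
  specialize (HM t Ht1).
  assert (f x <= f t).
  { apply derive_nonneg_le with df; trivial; intros; [apply Hd | apply Hp]; lra. }
  rewrite Rminus_0_r in HM. apply Rabs_def2 in HM. lra.
Qed.

(* A derivative bounded by the derivative of a function vanishing at infinity
   plays the part of a Taylor estimate along the orbit. *)
Lemma dominated_at_infinity (f df g dg : R -> R) (a : R) :
  (forall x, a <= x -> is_derive f x (df x)) ->
  (forall x, a <= x -> is_derive g x (dg x)) ->
  (forall x, a <= x -> Rabs (df x) <= - dg x) ->
  is_lim f p_infty 0 -> is_lim g p_infty 0 ->
  forall x, a <= x -> Rabs (f x) <= g x.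
Proof.
  intros Hf Hg Hb Lf Lg x Hx.
  assert (H1 : f x - g x <= 0).
  { apply nondecreasing_lim_zero_le with (f := fun t => f t - g t)
      (df := fun t => df t - dg t) (a := a); trivial.
    - intros t Ht. apply (is_derive_minus f g); auto.
    - intros t Ht. specialize (Hb t Ht). apply Rabs_le_between in Hb. lra.
    - replace 0 with (0 - 0) by ring. now apply is_lim_minus'. }
  assert (H2 : - (f x + g x) <= 0).
  { apply nondecreasing_lim_zero_le with (f := fun t => - (f t + g t))
      (df := fun t => - (df t + dg t)) (a := a); trivial.
    - intros t Ht. apply (is_derive_opp (fun t => f t + g t)).
      apply (is_derive_plus f g); auto.
    - intros t Ht. specialize (Hb t Ht). apply Rabs_le_between in Hb. lra.
    - replace (Finite 0) with (Rbar_opp (0 + 0)) by (simpl; f_equal; ring).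
      apply is_lim_opp. now apply is_lim_plus'. }
  apply Rabs_le. lra.
Qed.

Lemma dominated_from_zero (f df g dg : R -> R) :
  (forall x, 0 <= x -> is_derive f x (df x)) ->
  (forall x, 0 <= x -> is_derive g x (dg x)) ->
  (forall x, 0 <= x -> Rabs (df x) <= dg x) ->
  forall x, 0 <= x -> Rabs (f x - f 0) <= g x - g 0.
Proof.
  intros Hf Hg Hb x Hx.
  assert (H1 : g 0 - f 0 <= g x - f x).
  { apply derive_nonneg_le with (f := fun t => g t - f t)
      (df := fun t => dg t - df t); trivial; intros t Ht.
    - apply (is_derive_minus g f); [apply Hg | apply Hf]; lra.
    - specialize (Hb t (proj1 Ht)). apply Rabs_le_between in Hb. lra. }
  assert (H2 : g 0 + f 0 <= g x + f x).
  { apply derive_nonneg_le with (f := fun t => g t + f t)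
      (df := fun t => dg t + df t); trivial; intros t Ht.
    - apply (is_derive_plus g f); [apply Hg | apply Hf]; lra.
    - specialize (Hb t (proj1 Ht)). apply Rabs_le_between in Hb. lra. }
  apply Rabs_le. lra.
Qed.

(** A Landau-type inequality with step 1: the mean value theorem gives a point of [[x, x+1]] where
    [g] equals [f (x+1) - f x], and [g] moves from there to [x] by at most [B]. Only points to the
    right of [x] enter, so bounds by decreasing weights survive. *)
Lemma derive_interpolation (f g k : R -> R) (x A B : R) :
  (forall t, x <= t -> is_derive f t (g t)) ->
  (forall t, x <= t -> is_derive g t (k t)) ->
  (forall t, x <= t -> Rabs (f t) <= A) ->
  (forall t, x <= t -> Rabs (k t) <= B) ->
  Rabs (g x) <= 2 * A + B.
Proof.
  intros Hf Hg HA HB.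
  destruct (mean_value f g x (x + 1)) as [c [Hc E1]]; [lra | intros; apply Hf; lra |].
  destruct (mean_value g k x c) as [d [Hd E2]]; [lra | intros; apply Hg; lra |].
  assert (H1 := HA x ltac:(lra)). assert (H2 := HA (x + 1) ltac:(lra)).
  assert (H3 := HB d ltac:(lra)).
  replace (g x) with (f (x + 1) - f x - k d * (c - x)) by (rewrite <- E2, E1; ring).
  apply Rabs_le_between in H1, H2, H3.
  apply Rabs_le. nra.
Qed.

(** Needed because [solitary_wave] prescribes limits of the unknowns only, while the first integral
    also involves the limit of the derivative of the potential. It is [derive_interpolation] for
    [f - l] far out. *)
Lemma is_lim_derive_zero (f g k : R -> R) (l : R) :
  (forall t, is_derive f t (g t)) -> (forall t, is_derive g t (k t)) ->
  is_lim f p_infty l -> is_lim k p_infty 0 -> is_lim g p_infty 0.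
Proof.
  intros Hf Hg Lf Lk. apply is_lim_p_infty_ball. intros e He.
  destruct (proj1 (is_lim_p_infty_ball f l) Lf (e / 4)) as [M1 H1]; [lra|].
  destruct (proj1 (is_lim_p_infty_ball k 0) Lk (e / 4)) as [M2 H2]; [lra|].
  exists (Rmax M1 M2). intros x Hx.
  assert (HM1 := Rmax_l M1 M2). assert (HM2 := Rmax_r M1 M2).
  rewrite Rminus_0_r.
  apply Rle_lt_trans with (2 * (e / 4) + e / 4); [|lra].
  apply (derive_interpolation (fun t => f t - l) g k); intros t Ht.
  - apply is_derive_eq with (g t - 0); [|ring].
    apply (is_derive_minus f (fun _ => l)); trivial.
    apply (is_derive_const l t).
  - apply Hg.
  - apply Rlt_le, H1. lra.
  - specialize (H2 t ltac:(lra)). rewrite Rminus_0_r in H2. lra.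
Qed.

(** Integrating factor [exp (- mu * x)]. The gap [mu < lam] keeps the forcing off resonance: the
    solution grows at the rate of the forcing, at the cost of a factor involving [/ (lam - mu)].
    Used once for each factor of [D^2 - kap^2 = (D - kap)(D + kap)]. *)
Lemma linear_ode_growth (s g : R -> R) (mu lam K : R) :
  0 < K -> 0 < lam -> mu < lam ->
  (forall x, 0 <= x -> is_derive s x (mu * s x + g x)) ->
  (forall x, 0 <= x -> Rabs (g x) <= K * exp (lam * x)) ->
  Rabs (s 0) <= K ->
  forall x, 0 <= x -> Rabs (s x) <= K * (1 + / (lam - mu)) * exp (lam * x).
Proof.
  intros HK Hl Hm Hs Hg H0 x Hx.
  assert (Hi : 0 < / (lam - mu)) by (apply Rinv_0_lt_compat; lra).
  assert (H := dominated_from_zero (fun t => s t * exp (- mu * t))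
    (fun t => g t * exp (- mu * t))
    (fun t => K * / (lam - mu) * exp ((lam - mu) * t))
    (fun t => K * exp ((lam - mu) * t))).
  lapply H; [clear H; intros H|].
  2:{ intros t Ht. apply is_derive_eq with
        ((mu * s t + g t) * exp (- mu * t) + s t * (- mu * exp (- mu * t))); [|ring].
      apply (is_derive_mult s (fun t => exp (- mu * t))).
      - now apply Hs.
      - auto_derive; trivial; ring.
      - intros; apply Rmult_comm. }
  lapply H; [clear H; intros H|].
  2:{ intros t Ht. auto_derive; trivial. field. lra. }
  lapply H; [clear H; intros H|].
  2:{ intros t Ht. rewrite Rabs_mult, (Rabs_pos_eq (exp _)) by (left; apply exp_pos).
      replace ((lam - mu) * t) with (lam * t + - mu * t) by ring.
      rewrite exp_plus, <- Rmult_assoc.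
      apply Rmult_le_compat_r; [left; apply exp_pos | now apply Hg]. }
  specialize (H x Hx). cbv beta in H.
  rewrite !Rmult_0_r, exp_0, !Rmult_1_r in H.
  assert (Hb : Rabs (s x * exp (- mu * x)) <= K + K * / (lam - mu) * exp ((lam - mu) * x)).
  { apply Rabs_le_between in H, H0. apply Rabs_le.
    assert (0 < K * / (lam - mu)) by (apply Rmult_lt_0_compat; lra). lra. }
  assert (E : s x = (s x * exp (- mu * x)) * exp (mu * x)).
  { rewrite Rmult_assoc, <- exp_plus. replace (- mu * x + mu * x) with 0 by ring.
    rewrite exp_0; ring. }
  rewrite E, Rabs_mult, (Rabs_pos_eq (exp (mu * x))) by (left; apply exp_pos).
  apply Rle_trans with ((K + K * / (lam - mu) * exp ((lam - mu) * x)) * exp (mu * x)).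
  - apply Rmult_le_compat_r; [left; apply exp_pos | exact Hb].
  - rewrite Rmult_plus_distr_r, Rmult_assoc, <- exp_plus.
    replace ((lam - mu) * x + mu * x) with (lam * x) by ring.
    assert (exp (mu * x) <= exp (lam * x)).
    { destruct (Req_dec x 0) as [->|Hn]; [rewrite !Rmult_0_r; lra|].
      left; apply exp_increasing. nra. }
    nra.
Qed.

(** A one-sided comparison with [z 0 * cosh (b * x)]. The quantity [(z' + b z) exp (- b x)] is
    nondecreasing, hence at least [b z 0]; multiplying by [exp (2 b x)] bounds the derivative of
    [z exp (b x)] from below, and a second integration ends the proof. *)
Lemma convex_growth (z dz ddz : R -> R) (b : R) :
  0 < b ->
  (forall x, 0 <= x -> is_derive z x (dz x)) ->
  (forall x, 0 <= x -> is_derive dz x (ddz x)) ->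
  (forall x, 0 <= x -> b ^ 2 * z x <= ddz x) ->
  0 < z 0 -> dz 0 = 0 ->
  forall x, 0 <= x -> z 0 / 2 * exp (b * x) <= z x.
Proof.
  intros Hb Hz Hdz Hc H0 Hd0.
  assert (Hs : forall x, 0 <= x -> b * z 0 <= (dz x + b * z x) * exp (- b * x)).
  { intros x Hx.
    replace (b * z 0) with ((dz 0 + b * z 0) * exp (- b * 0))
      by (rewrite Hd0, Rmult_0_r, exp_0; ring).
    apply (derive_nonneg_le (fun t => (dz t + b * z t) * exp (- b * t))
      (fun t => (ddz t - b ^ 2 * z t) * exp (- b * t))); trivial.
    - intros t Ht. apply is_derive_eq with
        ((ddz t + b * dz t) * exp (- b * t)
         + (dz t + b * z t) * (- b * exp (- b * t))); [|ring].
      apply (is_derive_mult (fun t => dz t + b * z t) (fun t => exp (- b * t))).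
      + apply (is_derive_plus dz (fun t => b * z t)); [apply Hdz; lra|].
        apply is_derive_scal. apply Hz; lra.
      + auto_derive; trivial; ring.
      + intros; apply Rmult_comm.
    - intros t Ht. apply Rmult_le_pos; [|left; apply exp_pos].
      specialize (Hc t (proj1 Ht)). lra. }
  intros x Hx.
  assert (H : z 0 - z 0 / 2 <= z x * exp (b * x) - z 0 / 2 * exp (2 * b * x)).
  { replace (z 0 - z 0 / 2) with (z 0 * exp (b * 0) - z 0 / 2 * exp (2 * b * 0))
      by (rewrite !Rmult_0_r, exp_0; field).
    apply (derive_nonneg_le (fun t => z t * exp (b * t) - z 0 / 2 * exp (2 * b * t))
      (fun t => (dz t * exp (b * t) + z t * (b * exp (b * t)))
                - b * z 0 * exp (2 * b * t))); trivial.
    - intros t Ht.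
      apply (is_derive_minus (fun t => z t * exp (b * t))
               (fun t => z 0 / 2 * exp (2 * b * t))).
      + apply (is_derive_mult z (fun t => exp (b * t))).
        * apply Hz; lra.
        * auto_derive; trivial; ring.
        * intros; apply Rmult_comm.
      + auto_derive; trivial. field.
    - intros t Ht. specialize (Hs t (proj1 Ht)).
      replace (2 * b * t) with (b * t + b * t) by ring. rewrite exp_plus.
      assert (E : exp (- b * t) * exp (b * t) = 1).
      { rewrite <- exp_plus. replace (- b * t + b * t) with 0 by ring. apply exp_0. }
      assert (Hp := exp_pos (b * t)).
      assert (b * z 0 * exp (b * t) <= dz t + b * z t).
      { replace (dz t + b * z t)
          with ((dz t + b * z t) * exp (- b * t) * exp (b * t))
          by (rewrite Rmult_assoc, E; ring).
        now apply Rmult_le_compat_r; [left|]. }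
      nra. }
  replace (2 * b * x) with (b * x + b * x) in H by ring. rewrite exp_plus in H.
  assert (Hp := exp_pos (b * x)). nra.
Qed.

(** * Uniform bounds on all derivatives *)

(** The domain depends on the index as well as on the point, so that one notion serves both the
    half-line and the region [tail], whose extent varies with the wave. *)
Definition bounded_on {I : Type} (D : I -> R -> Prop) (F : I -> R -> R) : Prop :=
  exists C, 0 < C /\ forall i x, D i x -> Rabs (F i x) <= C.

Lemma bounded_on_le {I} (D : I -> R -> Prop) (F : I -> R -> R) (C : R) :
  (forall i x, D i x -> Rabs (F i x) <= C) -> bounded_on D F.
Proof.
  intros H. exists (Rmax C 1). split; [generalize (Rmax_r C 1); lra|].
  intros i x Hx. apply Rle_trans with C; [auto | apply Rmax_l].
Qed.

Lemma bounded_on_const {I} (D : I -> R -> Prop) (c : R) :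
  bounded_on D (fun _ _ => c).
Proof. apply bounded_on_le with (Rabs c). intros; lra. Qed.

Lemma bounded_on_plus {I} (D : I -> R -> Prop) (F G : I -> R -> R) :
  bounded_on D F -> bounded_on D G -> bounded_on D (fun i x => F i x + G i x).
Proof.
  intros [A [_ HA]] [B [_ HB]]. apply bounded_on_le with (A + B). intros i x H.
  apply Rle_trans with (1 := Rabs_triang _ _).
  specialize (HA i x H). specialize (HB i x H). lra.
Qed.

Lemma bounded_on_opp {I} (D : I -> R -> Prop) (F : I -> R -> R) :
  bounded_on D F -> bounded_on D (fun i x => - F i x).
Proof.
  intros [A [_ HA]]. apply bounded_on_le with A. intros i x H.
  rewrite Rabs_Ropp; auto.
Qed.

Lemma bounded_on_minus {I} (D : I -> R -> Prop) (F G : I -> R -> R) :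
  bounded_on D F -> bounded_on D G -> bounded_on D (fun i x => F i x - G i x).
Proof.
  intros HF HG. apply (bounded_on_plus D F (fun i x => - G i x)); trivial.
  now apply bounded_on_opp.
Qed.

Lemma bounded_on_mult {I} (D : I -> R -> Prop) (F G : I -> R -> R) :
  bounded_on D F -> bounded_on D G -> bounded_on D (fun i x => F i x * G i x).
Proof.
  intros [A [_ HA]] [B [_ HB]]. apply bounded_on_le with (A * B). intros i x H.
  rewrite Rabs_mult. apply Rmult_le_compat; auto using Rabs_pos.
Qed.

Lemma bounded_on_pow {I} (D : I -> R -> Prop) (F : I -> R -> R) (k : nat) :
  bounded_on D F -> bounded_on D (fun i x => F i x ^ k).
Proof.
  intros HF. induction k as [|k IH]; simpl.
  - apply bounded_on_const.
  - now apply bounded_on_mult.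
Qed.

(* Bounds on [0,+oo), with weight [wt] and uniform over the indices [i] in [S],
   for all derivatives of order at most [k]. *)
Fixpoint bounded_derivs {I : Type} (S : I -> Prop) (wt : R -> R) (k : nat)
    (F : I -> R -> R) : Prop :=
  bounded_on (fun i x => S i /\ 0 <= x) (fun i x => wt x * F i x) /\
  match k with
  | O => True
  | Datatypes.S k' =>
      exists F', (forall i, S i -> forall x, is_derive (F i) x (F' i x)) /\
                 bounded_derivs S wt k' F'
  end.

Section BoundedDerivs.

Context {I : Type} (S : I -> Prop).

Lemma bounded_derivs_0 (wt : R -> R) (k : nat) (F : I -> R -> R) :
  bounded_derivs S wt k F ->
  bounded_on (fun i x => S i /\ 0 <= x) (fun i x => wt x * F i x).
Proof. destruct k; now intros [H _]. Qed.

Lemma bounded_derivs_S (wt : R -> R) (k : nat) (F F' : I -> R -> R) :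
  bounded_derivs S wt 0 F ->
  (forall i, S i -> forall x, is_derive (F i) x (F' i x)) ->
  bounded_derivs S wt k F' -> bounded_derivs S wt (Datatypes.S k) F.
Proof. intros [H0 _] Hd H. split; trivial. now exists F'. Qed.

Lemma bounded_derivs_ext (wt : R -> R) (k : nat) (F G : I -> R -> R) :
  (forall i, S i -> forall x, F i x = G i x) ->
  bounded_derivs S wt k F -> bounded_derivs S wt k G.
Proof.
  intros E HF. destruct k as [|k]; destruct HF as [[C [HC H0]] HF];
    (split; [exists C; split; trivial; intros i x [Hi Hx]; rewrite <- E by trivial;
             now apply H0|]); trivial.
  destruct HF as [F' [Hd HF]]. exists F'. split; trivial.
  intros i Hi x. apply is_derive_ext with (F i); auto.
Qed.

Lemma bounded_derivs_pred (wt : R -> R) (k : nat) (F : I -> R -> R) :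
  bounded_derivs S wt (Datatypes.S k) F -> bounded_derivs S wt k F.
Proof.
  revert F; induction k as [|k IH]; intros F [H0 [F' [Hd H]]].
  - now split.
  - split; trivial. exists F'; auto.
Qed.

Lemma bounded_derivs_plus (wt : R -> R) (k : nat) (F G : I -> R -> R) :
  bounded_derivs S wt k F -> bounded_derivs S wt k G ->
  bounded_derivs S wt k (fun i x => F i x + G i x).
Proof.
  assert (Z : forall F G : I -> R -> R,
    bounded_on (fun i x => S i /\ 0 <= x) (fun i x => wt x * F i x) ->
    bounded_on (fun i x => S i /\ 0 <= x) (fun i x => wt x * G i x) ->
    bounded_on (fun i x => S i /\ 0 <= x) (fun i x => wt x * (F i x + G i x))).
  { clear. intros F G HF HG. destruct (bounded_on_plus _ _ _ HF HG) as [C [HC H]].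
    exists C; split; trivial. intros i x Hi. rewrite Rmult_plus_distr_l. now apply H. }
  revert F G; induction k as [|k IH]; intros F G [HF0 HF] [HG0 HG]; (split; [auto|]); trivial.
  destruct HF as [F' [HF' HF]]. destruct HG as [G' [HG' HG]].
  exists (fun i x => F' i x + G' i x). split; [|auto].
  intros i Hi x. apply (is_derive_plus (F i) (G i)); auto.
Qed.

(** Weights multiply, so one decaying factor with weight [wt] and any number of merely bounded
    factors with weight 1 yield a product with weight [wt]. The induction lowers the order of the
    undifferentiated factor in each Leibniz term. *)
Lemma bounded_derivs_mult (wt1 wt2 : R -> R) (k : nat) (F G : I -> R -> R) :
  bounded_derivs S wt1 k F -> bounded_derivs S wt2 k G ->
  bounded_derivs S (fun x => wt1 x * wt2 x) k (fun i x => F i x * G i x).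
Proof.
  assert (Z : forall F G : I -> R -> R,
    bounded_on (fun i x => S i /\ 0 <= x) (fun i x => wt1 x * F i x) ->
    bounded_on (fun i x => S i /\ 0 <= x) (fun i x => wt2 x * G i x) ->
    bounded_on (fun i x => S i /\ 0 <= x)
      (fun i x => wt1 x * wt2 x * (F i x * G i x))).
  { clear. intros F G HF HG. destruct (bounded_on_mult _ _ _ HF HG) as [C [HC H]].
    exists C; split; trivial. intros i x Hi.
    replace (wt1 x * wt2 x * (F i x * G i x)) with (wt1 x * F i x * (wt2 x * G i x)) by ring.
    now apply H. }
  revert F G; induction k as [|k IH]; intros F G HF HG.
  - split; [|trivial]. apply Z; [apply HF | apply HG].
  - assert (HF0 := bounded_derivs_pred _ _ _ HF).
    assert (HG0 := bounded_derivs_pred _ _ _ HG).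
    destruct HF as [BF [F' [HF' HF]]]. destruct HG as [BG [G' [HG' HG]]].
    split; [auto|].
    exists (fun i x => F' i x * G i x + F i x * G' i x). split.
    + intros i Hi x. apply (is_derive_mult (F i) (G i)); auto.
      intros; apply Rmult_comm.
    + apply bounded_derivs_plus; auto.
Qed.

Lemma bounded_derivs_weight_le (wt1 wt2 : R -> R) (k : nat) (F : I -> R -> R) :
  (forall x, 0 <= x -> 0 <= wt1 x <= wt2 x) ->
  bounded_derivs S wt2 k F -> bounded_derivs S wt1 k F.
Proof.
  intros Hw. revert F; induction k as [|k IH]; intros F [[C [HC H0]] H];
    (split; [exists C; split; trivial; intros i x Hi; apply Rle_trans with (2 := H0 i x Hi);
       specialize (Hw x (proj2 Hi)); rewrite !Rabs_mult;
       apply Rmult_le_compat_r; [apply Rabs_pos|]; rewrite !Rabs_pos_eq; lra|]); trivial.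
  destruct H as [F' [Hd H]]. exists F'. auto.
Qed.

Lemma bounded_derivs_param (k : nat) (c : I -> R) :
  (exists C, forall i, S i -> Rabs (c i) <= C) ->
  bounded_derivs S (fun _ => 1) k (fun i _ => c i).
Proof.
  intros [C HC]. revert c C HC. induction k as [|k IH]; intros c C HC;
    (split; [apply bounded_on_le with C; intros i x [Hi _]; rewrite Rmult_1_l; auto|]);
    trivial.
  exists (fun _ _ => 0). split.
  - intros i Hi x. apply (is_derive_const (c i) x).
  - apply (IH (fun _ => 0) 0). intros; rewrite Rabs_R0; lra.
Qed.

Lemma bounded_derivs_const (k : nat) (c : R) :
  bounded_derivs S (fun _ => 1) k (fun _ _ => c).
Proof. apply (bounded_derivs_param k (fun _ => c)). exists (Rabs c); intros; lra. Qed.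

Lemma bounded_derivs_mult_1 (k : nat) (F G : I -> R -> R) :
  bounded_derivs S (fun _ => 1) k F -> bounded_derivs S (fun _ => 1) k G ->
  bounded_derivs S (fun _ => 1) k (fun i x => F i x * G i x).
Proof.
  intros HF HG. apply bounded_derivs_weight_le with (fun _ => 1 * 1).
  - intros; lra.
  - now apply bounded_derivs_mult.
Qed.

Lemma bounded_derivs_mult_r (wt : R -> R) (k : nat) (F G : I -> R -> R) :
  (forall x, 0 <= x -> 0 <= wt x) ->
  bounded_derivs S (fun _ => 1) k F -> bounded_derivs S wt k G ->
  bounded_derivs S wt k (fun i x => F i x * G i x).
Proof.
  intros Hw HF HG. apply bounded_derivs_weight_le with (fun x => 1 * wt x).
  - intros x Hx. specialize (Hw x Hx). lra.
  - now apply bounded_derivs_mult.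
Qed.

Lemma bounded_derivs_mult_l (wt : R -> R) (k : nat) (F G : I -> R -> R) :
  (forall x, 0 <= x -> 0 <= wt x) ->
  bounded_derivs S wt k F -> bounded_derivs S (fun _ => 1) k G ->
  bounded_derivs S wt k (fun i x => F i x * G i x).
Proof.
  intros Hw HF HG. apply bounded_derivs_ext with (fun i x => G i x * F i x).
  - intros; ring.
  - now apply bounded_derivs_mult_r.
Qed.

Lemma bounded_derivs_opp (wt : R -> R) (k : nat) (F : I -> R -> R) :
  (forall x, 0 <= x -> 0 <= wt x) ->
  bounded_derivs S wt k F -> bounded_derivs S wt k (fun i x => - F i x).
Proof.
  intros Hw HF. apply bounded_derivs_ext with (fun i x => -1 * F i x).
  - intros; ring.
  - apply (bounded_derivs_mult_r wt k (fun _ _ => -1) F); trivial.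
    apply bounded_derivs_const.
Qed.

Lemma bounded_derivs_minus (wt : R -> R) (k : nat) (F G : I -> R -> R) :
  (forall x, 0 <= x -> 0 <= wt x) ->
  bounded_derivs S wt k F -> bounded_derivs S wt k G ->
  bounded_derivs S wt k (fun i x => F i x - G i x).
Proof.
  intros Hw HF HG. apply bounded_derivs_plus; trivial. now apply bounded_derivs_opp.
Qed.

Lemma bounded_derivs_pow (k j : nat) (F : I -> R -> R) :
  bounded_derivs S (fun _ => 1) k F ->
  bounded_derivs S (fun _ => 1) k (fun i x => F i x ^ j).
Proof.
  intros HF. induction j as [|j IH]; simpl.
  - apply bounded_derivs_const.
  - now apply bounded_derivs_mult_1.
Qed.

Lemma bounded_derivs_Derive_n (wt : R -> R) (k : nat) (F : I -> R -> R) :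
  bounded_derivs S wt k F ->
  bounded_on (fun i x => S i /\ 0 <= x) (fun i x => wt x * Derive_n (F i) k x).
Proof.
  revert F; induction k as [|k IH]; intros F HF.
  - exact (bounded_derivs_0 _ _ _ HF).
  - destruct HF as [_ [F' [Hd HF]]]. destruct (IH F' HF) as [C [HC H]].
    exists C; split; trivial. intros i x [Hi Hx].
    replace (Derive_n (F i) (Datatypes.S k) x) with (Derive_n (F' i) k x); auto.
    replace (Datatypes.S k) with (k + 1)%nat by lia.
    rewrite <- Derive_n_comp. apply Derive_n_ext. intros t. symmetry.
    apply is_derive_unique. auto.
Qed.

Lemma bounded_derivs_ex_derive_n (wt : R -> R) (k j : nat) (F : I -> R -> R) (i : I) (x : R) :
  bounded_derivs S wt k F -> S i -> (j <= k)%nat -> ex_derive_n (F i) j x.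
Proof.
  intros HF Hi. revert F j x HF; induction k as [|k IH]; intros F j x HF Hj.
  - now replace j with 0%nat by lia.
  - destruct HF as [_ [F' [Hd HF]]].
    destruct j as [|[|j]]; [exact Logic.I | exists (F' i x); now apply Hd |].
    assert (H := IH F' (Datatypes.S j) x HF ltac:(lia)).
    change (ex_derive (Derive_n (F i) (Datatypes.S j)) x).
    change (ex_derive (Derive_n (F' i) j) x) in H.
    apply (ex_derive_ext (Derive_n (F' i) j)); [|exact H].
    intros t. replace (Datatypes.S j) with (j + 1)%nat by lia.
    rewrite <- Derive_n_comp. apply Derive_n_ext. intros s. symmetry.
    apply is_derive_unique. now apply Hd.
Qed.

(** Transfers half-line bounds to the line, since the [k]-th derivative of an even function has the
    parity of [k]. Differentiability near negative points is available because [bounded_derivs]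
    restricts only the bounds, not the derivatives, to the half-line. *)
Lemma bounded_derivs_even (wt : R -> R) (k : nat) (F : I -> R -> R) (i : I) :
  bounded_derivs S wt k F -> S i -> (forall x, F i (- x) = F i x) ->
  forall x, Rabs (Derive_n (F i) k x) = Rabs (Derive_n (F i) k (Rabs x)).
Proof.
  intros HF Hi Ev x. unfold Rabs at 3. destruct (Rcase_abs x) as [Hx|Hx]; trivial.
  rewrite <- (Derive_n_ext (fun y => F i (- y)) (F i) k x) by apply Ev.
  rewrite Derive_n_comp_opp.
  - rewrite Rabs_mult, <- RPow_abs. replace (Rabs (-1)) with 1 by (rewrite Rabs_left; lra).
    rewrite pow1. ring.
  - exists (mkposreal 1 Rlt_0_1). intros y _ j Hj.
    now apply bounded_derivs_ex_derive_n with wt k.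
Qed.

End BoundedDerivs.

(** * The rescaled travelling-wave system *)

(** [eps] is a field rather than a parameter: quantifying over [wave] then ranges over all small
    [eps] and all solutions at once, which is the uniformity asked of the constants. *)
Record wave (sigma gamma : R) : Type := Wave {
  eps : R; dens : R -> R; vel : R -> R; pot : R -> R;
  eps_pos : 0 < eps;
  is_solitary : solitary_wave sigma gamma eps dens vel pot }.

Arguments eps {sigma gamma} _.
Arguments dens {sigma gamma} _ _.
Arguments vel {sigma gamma} _ _.
Arguments pot {sigma gamma} _ _.
Arguments eps_pos {sigma gamma} _.
Arguments is_solitary {sigma gamma} _.

Section SolitaryWaves.

Context (sigma gamma : R) (Hsigma : 0 <= sigma) (Hgamma : 0 < gamma).

Local Notation wave := (wave sigma gamma).
Local Notation V := (Vspeed sigma).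

Definition a0 : R := 2 * V * gamma.

Lemma V_pos : 0 < V.
Proof. apply sqrt_lt_R0. lra. Qed.

Lemma V_sqr : V ^ 2 = 1 + sigma.
Proof. unfold Vspeed. rewrite <- Rsqr_pow2. apply Rsqr_sqrt. lra. Qed.

Lemma a0_pos : 0 < a0.
Proof. unfold a0. assert (H := V_pos). nra. Qed.

(* [dd] and [c2] are the coefficients in c^2 = c2 = V^2 + eps dd, c = V + gamma eps. *)
Definition dd (i : wave) : R := a0 + gamma ^ 2 * eps i.
Definition c2 (i : wave) : R := V ^ 2 + eps i * dd i.

(* The wave is rescaled as n = 1 + eps M, phi = eps W, P = W'. *)
Definition M (i : wave) (x : R) : R := (dens i x - 1) / eps i.
Definition dM (i : wave) (x : R) : R := Derive (dens i) x / eps i.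
Definition W (i : wave) (x : R) : R := pot i x / eps i.
Definition P (i : wave) (x : R) : R := Derive (pot i) x / eps i.
Definition Y (i : wave) (x : R) : R := (W i x - M i x) / eps i.
Definition E1 (i : wave) (x : R) : R := (exp (pot i x) - 1) / eps i.
Definition E2 (i : wave) (x : R) : R := (exp (pot i x) - 1 - pot i x) / eps i ^ 2.
Definition I0 (i : wave) (x : R) : R := / dens i x.
(** The divided difference of [h] as a polynomial in [I0]: [h - (c2 - sigma) = (I0 - 1) * r], where
    [I0 - 1 = - eps M I0]. This makes [(h - 1) / eps = q] an expression without division by
    [eps]. *)
Definition r (i : wave) (x : R) : R := c2 i * (1 + I0 i x + I0 i x ^ 2) - sigma.
Definition q (i : wave) (x : R) : R := dd i - M i x * I0 i x * r i x.
(* phi is a function of n with dphi/dn = h = 1 + eps q. *)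
Definition h (i : wave) (x : R) : R := c2 i * I0 i x ^ 3 - sigma * I0 i x.
Definition J (i : wave) (x : R) : R := / h i x.
(** Formally [E2] is [W^2 / 2] and [Y] is [a0 W - (3 V^2 - sigma) / 2 * W^2] to leading order; since
    [1 + sigma = V^2] these sum to [a0 W - V^2 W^2], so the division by [eps] should leave a bounded
    quantity. That is proved through the derivative. *)
Definition err (i : wave) (x : R) : R :=
  (E2 i x + Y i x - a0 * W i x + V ^ 2 * W i x ^ 2) / eps i.
(** The cofactor of [P] in the derivative of [err]: what remains after the terms of order zero
    cancel and one factor [eps] is divided out. *)
Definition rho (i : wave) (x : R) : R :=
  E2 i x + gamma ^ 2 + (3 * V ^ 2 - sigma) * Y i x
  - M i x * (3 * dd i - c2 i * M i x * I0 i x * (2 + I0 i x))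
  + M i x ^ 2 * I0 i x * r i x - q i x ^ 2 * J i x.

Lemma smooth_is_derive (f : R -> R) (x : R) : smooth f -> is_derive f x (Derive f x).
Proof. intros H. apply Derive_correct. exact (H 1%nat x). Qed.

Lemma smooth_is_derive_2 (f : R -> R) (x : R) :
  smooth f -> is_derive (Derive f) x (Derive_n f 2 x).
Proof. intros H. apply Derive_correct. exact (H 2%nat x). Qed.

Lemma c2_speed (i : wave) : c2 i = (V + gamma * eps i) ^ 2.
Proof. unfold c2, dd, a0. ring. Qed.

Lemma derive_even_0 (f : R -> R) :
  (forall x, f (- x) = f x) -> smooth f -> Derive f 0 = 0.
Proof.
  intros Ev Sf. assert (X : Derive f 0 = - Derive f 0); [|lra].
  rewrite <- (Derive_ext (fun y => f (- y)) f) at 1 by apply Ev.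
  rewrite Derive_comp; [|exact (Sf 1%nat _)|auto_derive; trivial].
  rewrite Derive_opp, Derive_id, Ropp_0. ring.
Qed.

(** * Sign and monotonicity of the wave, and integration of the flow equations *)

Lemma dens_derive_neg (i : wave) (x : R) : 0 < x -> Derive (dens i) x < 0.
Proof. intros Hx. now apply (is_solitary i). Qed.

Lemma pot_derive_neg (i : wave) (x : R) : 0 < x -> Derive (pot i) x < 0.
Proof. intros Hx. now apply (is_solitary i). Qed.

Lemma dens_smooth (i : wave) : smooth (dens i).
Proof. apply (is_solitary i). Qed.

Lemma vel_smooth (i : wave) : smooth (vel i).
Proof. apply (is_solitary i). Qed.

Lemma pot_smooth (i : wave) : smooth (pot i).
Proof. apply (is_solitary i). Qed.

Lemma dens_even (i : wave) (x : R) : dens i (- x) = dens i x.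
Proof. apply (is_solitary i). Qed.

Lemma pot_even (i : wave) (x : R) : pot i (- x) = pot i x.
Proof. apply (is_solitary i). Qed.

Lemma dens_lim (i : wave) : is_lim (dens i) p_infty 1.
Proof. apply (is_solitary i). Qed.

Lemma vel_lim (i : wave) : is_lim (vel i) p_infty 0.
Proof. apply (is_solitary i). Qed.

Lemma pot_lim (i : wave) : is_lim (pot i) p_infty 0.
Proof. apply (is_solitary i). Qed.

Lemma dens_derive_nonpos (i : wave) (x : R) : 0 <= x -> Derive (dens i) x <= 0.
Proof.
  intros [Hx| <-]; [left; now apply dens_derive_neg|].
  rewrite derive_even_0; [lra | apply dens_even | apply dens_smooth].
Qed.

Lemma pot_derive_nonpos (i : wave) (x : R) : 0 <= x -> Derive (pot i) x <= 0.
Proof.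
  intros [Hx| <-]; [left; now apply pot_derive_neg|].
  rewrite derive_even_0; [lra | apply pot_even | apply pot_smooth].
Qed.

Lemma dens_decr (i : wave) (x y : R) : 0 <= x -> x <= y -> dens i y <= dens i x.
Proof.
  intros Hx Hy. cut (- dens i x <= - dens i y); [lra|].
  apply derive_nonneg_le with (f := fun t => - dens i t)
    (df := fun t => - Derive (dens i) t); trivial; intros t Ht.
  - apply (is_derive_opp (dens i)). apply smooth_is_derive, dens_smooth.
  - assert (H := dens_derive_nonpos i t ltac:(lra)). lra.
Qed.

Lemma dens_gt_1 (i : wave) (x : R) : 1 < dens i x.
Proof.
  assert (H : forall t, 0 <= t -> 1 < dens i t).
  { assert (H1 : forall t, 0 <= t -> 1 - dens i t <= 0).
    { apply nondecreasing_lim_zero_le with (f := fun t => 1 - dens i t)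
        (df := fun t => 0 - Derive (dens i) t).
      - intros t Ht. apply (is_derive_minus (fun _ => 1) (dens i)).
        + apply (is_derive_const 1 t).
        + apply smooth_is_derive, dens_smooth.
      - intros t Ht. assert (H := dens_derive_nonpos i t Ht). lra.
      - replace 0 with (1 - 1) by ring.
        apply is_lim_minus'; [apply is_lim_const | apply dens_lim]. }
    (* The shift by 1 keeps the mean value point away from 0, where the derivative vanishes and
       would give no strict inequality. *)
    intros t Ht. apply Rlt_le_trans with (dens i (t + 1)); [|apply dens_decr; lra].
    destruct (mean_value (dens i) (Derive (dens i)) (t + 1) (t + 2)) as [c [Hc E]];
      [lra | intros; apply smooth_is_derive, dens_smooth |].
    assert (D := dens_derive_neg i c ltac:(lra)).
    specialize (H1 (t + 2) ltac:(lra)). lra. }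
  destruct (Rle_or_lt 0 x) as [Hx|Hx]; [now apply H|].
  rewrite <- dens_even. apply H. lra.
Qed.

(** First integral of the continuity equation; the limits at infinity fix the constant. A function
    with zero derivative and zero limit is dominated by the zero function. *)
Lemma dens_vel (i : wave) (x : R) :
  dens i x * vel i x - (V + gamma * eps i) * dens i x = - (V + gamma * eps i).
Proof.
  set (c := V + gamma * eps i).
  set (f := fun t => dens i t * vel i t - c * dens i t + c).
  assert (Hd : forall t, is_derive f t 0).
  { intros t.
    assert (Hp : is_derive (fun t => dens i t * vel i t) t
                   (Derive (fun t => dens i t * vel i t) t)).
    { apply Derive_correct. apply ex_derive_mult;
        [exact (dens_smooth i 1%nat t) | exact (vel_smooth i 1%nat t)]. }
    assert (Eq : - c * Derive (dens i) t + Derive (fun x => dens i x * vel i x) t = 0)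
      by apply (is_solitary i).
    apply is_derive_eq with
      (Derive (fun t => dens i t * vel i t) t - c * Derive (dens i) t + 0); [|lra].
    apply (is_derive_plus (fun t => dens i t * vel i t - c * dens i t) (fun _ => c)).
    - apply (is_derive_minus (fun t => dens i t * vel i t) (fun t => c * dens i t)); trivial.
      apply is_derive_scal, smooth_is_derive, dens_smooth.
    - apply (is_derive_const c t). }
  assert (Hl : is_lim f p_infty 0).
  { replace 0 with (1 * 0 - c * 1 + c) by ring.
    apply is_lim_plus'; [|apply is_lim_const].
    apply is_lim_minus'.
    - apply (is_lim_mult _ _ _ 1 0); [apply dens_lim | apply vel_lim | exact I].
    - apply (is_lim_scal_l _ c p_infty 1), dens_lim. }
  assert (H0 : Rabs (f x) <= 0).
  { apply (dominated_at_infinity f (fun _ => 0) (fun _ => 0) (fun _ => 0) x); trivial.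
    - intros; apply (is_derive_const 0).
    - intros; rewrite Rabs_R0; lra.
    - apply is_lim_const.
    - lra. }
  assert (H1 := Rabs_pos (f x)).
  assert (H2 : f x = 0) by (apply Rabs_eq_0; lra). unfold f in H2. lra.
Qed.

Lemma vel_eq (i : wave) (x : R) :
  vel i x = (V + gamma * eps i) * (1 - / dens i x).
Proof.
  assert (H := dens_vel i x). assert (Hn := dens_gt_1 i x).
  replace (vel i x) with ((dens i x * vel i x) / dens i x) by (field; lra).
  replace (dens i x * vel i x) with
    ((V + gamma * eps i) * dens i x - (V + gamma * eps i)) by lra.
  field. lra.
Qed.

Lemma I0_derive (i : wave) (x : R) :
  is_derive (I0 i) x (- eps i * dM i x * I0 i x ^ 2).
Proof.
  assert (Hn := dens_gt_1 i x). assert (He := eps_pos i).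
  unfold I0, dM.
  apply is_derive_eq with (- Derive (dens i) x / dens i x ^ 2).
  - apply is_derive_inv; [apply smooth_is_derive, dens_smooth | lra].
  - field. split; lra.
Qed.

Lemma M_derive (i : wave) (x : R) : is_derive (M i) x (dM i x).
Proof.
  unfold M, dM, Rdiv.
  apply is_derive_congr with (fun t => / eps i * (dens i t - 1)); [intros; ring|].
  apply is_derive_eq with (/ eps i * (Derive (dens i) x - 0)); [|ring].
  apply is_derive_scal, (is_derive_minus (dens i) (fun _ => 1)).
  - apply smooth_is_derive, dens_smooth.
  - apply (is_derive_const 1 x).
Qed.

Lemma W_derive (i : wave) (x : R) : is_derive (W i) x (P i x).
Proof.
  unfold W, P, Rdiv.
  apply is_derive_congr with (fun t => / eps i * pot i t); [intros; ring|].
  rewrite Rmult_comm. apply is_derive_scal, smooth_is_derive, pot_smooth.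
Qed.

Lemma P_derive (i : wave) (x : R) : is_derive (P i) x (E2 i x + Y i x).
Proof.
  assert (He := eps_pos i).
  unfold P, Rdiv.
  apply is_derive_congr with (fun t => / eps i * Derive (pot i) t); [intros; ring|].
  apply is_derive_eq with (/ eps i * Derive_n (pot i) 2 x).
  - apply is_derive_scal, smooth_is_derive_2, pot_smooth.
  - assert (Eq : eps i * Derive_n (pot i) 2 x = exp (pot i x) - dens i x)
      by apply (is_solitary i).
    unfold E2, Y, W, M.
    replace (Derive_n (pot i) 2 x) with ((exp (pot i x) - dens i x) / eps i)
      by (rewrite <- Eq; field; lra).
    field. lra.
Qed.

(** The choice of [V] enters here: [V^2 = 1 + sigma] gives [c2 - sigma = 1 + eps dd], so the density
    and the potential agree to first order in [eps]. *)
Lemma h_eq (i : wave) (x : R) : h i x = 1 + eps i * q i x.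
Proof.
  assert (Hn := dens_gt_1 i x). assert (He := eps_pos i). assert (HV := V_sqr).
  unfold h, q, r.
  assert (E : eps i * M i x * I0 i x = 1 - I0 i x).
  { unfold M, I0. field. lra. }
  replace (1 + eps i * (dd i - M i x * I0 i x * (c2 i * (1 + I0 i x + I0 i x ^ 2) - sigma)))
    with (1 + eps i * dd i
          - eps i * M i x * I0 i x * (c2 i * (1 + I0 i x + I0 i x ^ 2) - sigma)) by ring.
  rewrite E. replace (1 + eps i * dd i) with (c2 i - sigma); [ring|].
  unfold c2. rewrite HV. ring.
Qed.

(** With [c = V + gamma eps] and [u = c (1 - 1/n)], the momentum equation has [u - c = - c/n] and
    [u' = c n' / n^2], so it becomes [phi' = (c^2 / n^3 - sigma / n) n']. *)
Lemma P_eq (i : wave) (x : R) : P i x = h i x * dM i x.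
Proof.
  assert (Hn := dens_gt_1 i x). assert (He := eps_pos i).
  set (c := V + gamma * eps i).
  assert (Hv : Derive (vel i) x = c * (Derive (dens i) x / dens i x ^ 2)).
  { rewrite (Derive_ext (vel i) (fun t => c * (1 - / dens i t))) by apply vel_eq.
    apply is_derive_unique.
    apply is_derive_scal.
    apply is_derive_eq with (0 - - Derive (dens i) x / dens i x ^ 2); [|field; lra].
    apply (is_derive_minus (fun _ => 1) (fun t => / dens i t)).
    - apply (is_derive_const 1 x).
    - apply is_derive_inv; [apply smooth_is_derive, dens_smooth | lra]. }
  assert (Eq : - c * Derive (vel i) x + vel i x * Derive (vel i) x
               + sigma * Derive (dens i) x / dens i x = - Derive (pot i) x)
    by apply (is_solitary i).
  rewrite Hv, vel_eq in Eq. fold c in Eq.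
  unfold P, h, dM, I0. rewrite c2_speed. fold c.
  replace (Derive (pot i) x) with (- - Derive (pot i) x) by ring.
  rewrite <- Eq. field. lra.
Qed.

Lemma Y_derive (i : wave) (x : R) : is_derive (Y i) x (dM i x * q i x).
Proof.
  assert (He := eps_pos i). unfold Y, Rdiv.
  apply is_derive_congr with (fun t => / eps i * (W i t - M i t)); [intros; ring|].
  apply is_derive_eq with (/ eps i * (P i x - dM i x)).
  - apply is_derive_scal, (is_derive_minus (W i) (M i)); [apply W_derive | apply M_derive].
  - rewrite P_eq, h_eq. field. lra.
Qed.

Lemma pot_derive (i : wave) (x : R) : is_derive (pot i) x (eps i * P i x).
Proof.
  assert (He := eps_pos i). apply is_derive_eq with (Derive (pot i) x).
  - apply smooth_is_derive, pot_smooth.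
  - unfold P. field. lra.
Qed.

Lemma exp_pot_derive (i : wave) (x : R) :
  is_derive (fun t => exp (pot i t)) x (eps i * P i x * exp (pot i x)).
Proof.
  apply (is_derive_comp exp (pot i)); [apply is_derive_exp | apply pot_derive].
Qed.

Lemma E1_derive (i : wave) (x : R) : is_derive (E1 i) x (P i x * (1 + eps i * E1 i x)).
Proof.
  assert (He := eps_pos i). unfold E1.
  apply is_derive_congr with (fun t => / eps i * (exp (pot i t) - 1)); [intros; unfold Rdiv; ring|].
  apply is_derive_eq with (/ eps i * (eps i * P i x * exp (pot i x) - 0)); [|field; lra].
  apply is_derive_scal, (is_derive_minus (fun t => exp (pot i t)) (fun _ => 1)).
  - apply exp_pot_derive.
  - apply (is_derive_const 1 x).
Qed.

Lemma E2_derive (i : wave) (x : R) : is_derive (E2 i) x (P i x * E1 i x).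
Proof.
  assert (He := eps_pos i). unfold E2, E1.
  apply is_derive_congr with (fun t => / eps i ^ 2 * (exp (pot i t) - 1 - pot i t));
    [intros; unfold Rdiv; ring|].
  apply is_derive_eq with
    (/ eps i ^ 2 * (eps i * P i x * exp (pot i x) - 0 - eps i * P i x)); [|field; lra].
  apply is_derive_scal.
  apply (is_derive_minus (fun t => exp (pot i t) - 1) (pot i)); [|apply pot_derive].
  apply (is_derive_minus (fun t => exp (pot i t)) (fun _ => 1)).
  - apply exp_pot_derive.
  - apply (is_derive_const 1 x).
Qed.

(** The numerator of [err] has derivative [P] times [E1 + q J - a0 + 2 V^2 W]. Each term is replaced
    by its leading value plus [eps] times an exact remainder; the leading values cancel and the
    remainders add up to [rho]. *)
Lemma err_derive (i : wave) (x : R) :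
  h i x <> 0 -> is_derive (err i) x (P i x * rho i x).
Proof.
  intros Hh. assert (He := eps_pos i). assert (HV := V_sqr).
  assert (Hn := dens_gt_1 i x).
  unfold err.
  apply is_derive_congr with
    (fun t => / eps i * (E2 i t + Y i t - a0 * W i t + V ^ 2 * (W i t * W i t)));
    [intros; unfold Rdiv; ring|].
  apply is_derive_eq with
    (/ eps i * (P i x * E1 i x + dM i x * q i x - a0 * P i x
                + V ^ 2 * (P i x * W i x + W i x * P i x))).
  - apply is_derive_scal.
    apply (is_derive_plus (fun t => E2 i t + Y i t - a0 * W i t)
             (fun t => V ^ 2 * (W i t * W i t))).
    + apply (is_derive_minus (fun t => E2 i t + Y i t) (fun t => a0 * W i t)).
      * apply (is_derive_plus (E2 i) (Y i)); [apply E2_derive | apply Y_derive].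
      * apply is_derive_scal, W_derive.
    + apply is_derive_scal, (is_derive_mult (W i) (W i)); try apply W_derive.
      intros; apply Rmult_comm.
  - assert (HM : dM i x = P i x * J i x) by (rewrite P_eq; unfold J; field; exact Hh).
    rewrite HM.
    assert (HJ : J i x = 1 - eps i * q i x * J i x).
    { apply Rmult_eq_reg_l with (h i x); trivial. rewrite h_eq at 2.
      unfold J. rewrite h_eq in *. field. trivial. }
    assert (H1 : E1 i x = W i x + eps i * E2 i x) by (unfold E1, W, E2; field; lra).
    assert (HI : I0 i x = 1 - eps i * M i x * I0 i x) by (unfold M, I0; field; lra).
    assert (HY : M i x = W i x - eps i * Y i x) by (unfold Y; field; lra).
    apply Rmult_eq_reg_l with (eps i); [|lra].
    rewrite <- Rmult_assoc, Rinv_r, Rmult_1_l by lra.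
    assert (Hr : r i x = 3 * V ^ 2 - sigma
       + eps i * (3 * dd i - c2 i * M i x * I0 i x * (2 + I0 i x))).
    { unfold r.
      replace (1 + I0 i x + I0 i x ^ 2) with
        (3 - eps i * M i x * I0 i x * (2 + I0 i x)).
      - unfold c2. ring.
      - assert (X : eps i * M i x * I0 i x = 1 - I0 i x) by lra. rewrite X. ring. }
    assert (Hq : q i x = a0 + gamma ^ 2 * eps i - M i x * r i x
                 + eps i * M i x ^ 2 * I0 i x * r i x).
    { unfold q, dd.
      assert (X : M i x * I0 i x * r i x =
                  M i x * (1 - eps i * M i x * I0 i x) * r i x) by (rewrite <- HI; ring).
      rewrite X. ring. }
    assert (Hq' : q i x = a0 - (3 * V ^ 2 - sigma) * W i x
       + eps i * (gamma ^ 2 + (3 * V ^ 2 - sigma) * Y i x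
         - M i x * (3 * dd i - c2 i * M i x * I0 i x * (2 + I0 i x))
         + M i x ^ 2 * I0 i x * r i x)).
    { rewrite Hq at 1.
      assert (X : M i x * r i x = (W i x - eps i * Y i x) * (3 * V ^ 2 - sigma)
        + eps i * M i x * (3 * dd i - c2 i * M i x * I0 i x * (2 + I0 i x))).
      { rewrite <- HY. rewrite Hr at 1. ring. }
      rewrite X. ring. }
    assert (HqJ : q i x * J i x = q i x - eps i * (q i x ^ 2 * J i x)).
    { transitivity (q i x * (1 - eps i * q i x * J i x)); [rewrite <- HJ; ring | ring]. }
    replace (P i x * J i x * q i x) with (P i x * (q i x * J i x)) by ring.
    rewrite HqJ, H1.
    unfold rho. set (T := q i x ^ 2 * J i x).
    rewrite Hq'.
    (* The cancellation at order zero: the coefficient of [W] is 1 from [E1] and [2 V^2] from the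
       derivative of [V^2 W^2], against [3 V^2 - sigma] from [q]. *)
    assert (Hs : 1 + 2 * V ^ 2 = 3 * V ^ 2 - sigma) by (rewrite HV; ring).
    rewrite <- Hs. ring.
Qed.


Lemma M_lim (i : wave) : is_lim (M i) p_infty 0.
Proof.
  apply (is_lim_ext (fun t => / eps i * (dens i t - 1))).
  { intros; unfold M, Rdiv; ring. }
  replace 0 with (/ eps i * (1 - 1)) by ring.
  apply (is_lim_scal_l _ (/ eps i) p_infty (1 - 1)).
  apply is_lim_minus'; [apply dens_lim | apply is_lim_const].
Qed.

Lemma W_lim (i : wave) : is_lim (W i) p_infty 0.
Proof.
  apply (is_lim_ext (fun t => / eps i * pot i t)).
  { intros; unfold W, Rdiv; ring. }
  replace 0 with (/ eps i * 0) by ring.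
  apply (is_lim_scal_l _ (/ eps i) p_infty 0), pot_lim.
Qed.

Lemma Y_lim (i : wave) : is_lim (Y i) p_infty 0.
Proof.
  apply (is_lim_ext (fun t => / eps i * (W i t - M i t))).
  { intros; unfold Y, Rdiv; ring. }
  replace 0 with (/ eps i * (0 - 0)) by ring.
  apply (is_lim_scal_l _ (/ eps i) p_infty (0 - 0)).
  apply is_lim_minus'; [apply W_lim | apply M_lim].
Qed.

Lemma exp_pot_lim (i : wave) : is_lim (fun t => exp (pot i t)) p_infty 1.
Proof.
  rewrite <- exp_0. apply is_lim_comp_continuous_at; [apply pot_lim|].
  apply (ex_derive_continuous exp 0). exists (exp 0). apply is_derive_exp.
Qed.

Lemma E1_lim (i : wave) : is_lim (E1 i) p_infty 0.
Proof.
  apply (is_lim_ext (fun t => / eps i * (exp (pot i t) - 1))).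
  { intros; unfold E1, Rdiv; ring. }
  replace 0 with (/ eps i * (1 - 1)) by ring.
  apply (is_lim_scal_l _ (/ eps i) p_infty (1 - 1)).
  apply is_lim_minus'; [apply exp_pot_lim | apply is_lim_const].
Qed.

Lemma E2_lim (i : wave) : is_lim (E2 i) p_infty 0.
Proof.
  apply (is_lim_ext (fun t => / eps i ^ 2 * (exp (pot i t) - 1 - pot i t))).
  { intros; unfold E2, Rdiv; ring. }
  replace 0 with (/ eps i ^ 2 * (1 - 1 - 0)) by ring.
  apply (is_lim_scal_l _ (/ eps i ^ 2) p_infty (1 - 1 - 0)).
  apply is_lim_minus'; [|apply pot_lim].
  apply is_lim_minus'; [apply exp_pot_lim | apply is_lim_const].
Qed.

Lemma P_lim (i : wave) : is_lim (P i) p_infty 0.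
Proof.
  apply (is_lim_derive_zero (W i) (P i) (fun t => E2 i t + Y i t) 0).
  - apply W_derive.
  - apply P_derive.
  - apply W_lim.
  - replace 0 with (0 + 0) by ring.
    apply is_lim_plus'; [apply E2_lim | apply Y_lim].
Qed.

Lemma W_pow_lim (i : wave) (k : nat) : is_lim (fun t => W i t ^ S k) p_infty 0.
Proof.
  replace 0 with (0 ^ S k) by (simpl; ring).
  apply (is_lim_comp_continuous_at (W i) (fun y => y ^ S k)); [apply W_lim|].
  apply (ex_derive_continuous (fun y => y ^ S k) 0). auto_derive; trivial.
Qed.

Lemma err_lim (i : wave) : is_lim (err i) p_infty 0.
Proof.
  apply (is_lim_ext (fun t => / eps i * (E2 i t + Y i t - a0 * W i t + V ^ 2 * W i t ^ 2))).
  { intros; unfold err, Rdiv; ring. }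
  replace 0 with (/ eps i * (0 + 0 - a0 * 0 + V ^ 2 * 0)) by ring.
  apply (is_lim_scal_l _ (/ eps i) p_infty (0 + 0 - a0 * 0 + V ^ 2 * 0)).
  apply is_lim_plus'.
  - apply is_lim_minus'.
    + apply is_lim_plus'; [apply E2_lim | apply Y_lim].
    + apply (is_lim_scal_l _ a0 p_infty 0), W_lim.
  - apply (is_lim_scal_l _ (V ^ 2) p_infty 0), W_pow_lim.
Qed.

Lemma M_pos (i : wave) (x : R) : 0 < M i x.
Proof.
  assert (H := dens_gt_1 i x). unfold M. apply Rdiv_lt_0_compat; [lra | apply eps_pos].
Qed.

Lemma M_decr (i : wave) (x y : R) : 0 <= x -> x <= y -> M i y <= M i x.
Proof.
  intros Hx Hy. assert (H := dens_decr i x y Hx Hy). unfold M, Rdiv.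
  apply Rmult_le_compat_r; [|lra]. left. apply Rinv_0_lt_compat, eps_pos.
Qed.

Lemma dM_nonpos (i : wave) (x : R) : 0 <= x -> dM i x <= 0.
Proof.
  intros Hx. assert (H := dens_derive_nonpos i x Hx). unfold dM, Rdiv.
  assert (0 < / eps i) by (apply Rinv_0_lt_compat, eps_pos). nra.
Qed.

Lemma P_nonpos (i : wave) (x : R) : 0 <= x -> P i x <= 0.
Proof.
  intros Hx. assert (H := pot_derive_nonpos i x Hx). unfold P, Rdiv.
  assert (0 < / eps i) by (apply Rinv_0_lt_compat, eps_pos). nra.
Qed.

Lemma I0_bounds (i : wave) (x : R) : 0 < I0 i x <= 1.
Proof.
  assert (H := dens_gt_1 i x). unfold I0. split.
  - apply Rinv_0_lt_compat; lra.
  - rewrite <- Rinv_1. apply Rinv_le_contravar; lra.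
Qed.

(** * Estimates where M <= K1 *)

(* [K1] exceeds the KdV amplitude [3 gamma / V] by a factor that survives [W >= M / 2]. *)
Definition K1 : R := 8 * gamma / V.
Definition Q1 : R := a0 + gamma ^ 2 + K1 * (3 * (V ^ 2 + (a0 + gamma ^ 2)) + sigma).
(** Secures both [eps <= 1] and [eps * Q1 <= 1/2]; as [Q1] bounds [q], this confines [h = 1 + eps q]
    to [[1/2, 3/2]]. *)
Definition eps0 : R := / (1 + 2 * Q1).

(** The amplitude bound is part of the hypothesis because no bound on [M] is known yet. Since [M]
    decreases, the region is stable to the right, so estimates can be integrated from infinity
    inside it. *)
Definition tail (i : wave) (x : R) : Prop := eps i <= eps0 /\ 0 <= x /\ M i x <= K1.

Lemma K1_pos : 0 < K1.
Proof. apply Rdiv_lt_0_compat; [lra | apply V_pos]. Qed.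

Lemma Q1_pos : 0 < Q1.
Proof.
  unfold Q1. assert (H := K1_pos). assert (H1 := a0_pos). assert (H2 := pow2_ge_0 gamma).
  assert (H3 := pow2_ge_0 V).
  assert (0 <= K1 * (3 * (V ^ 2 + (a0 + gamma ^ 2)) + sigma)) by (apply Rmult_le_pos; lra).
  lra.
Qed.

Lemma eps0_pos : 0 < eps0.
Proof. assert (H := Q1_pos). apply Rinv_0_lt_compat. lra. Qed.

Lemma tail_later (i : wave) (x y : R) : tail i x -> x <= y -> tail i y.
Proof.
  intros (H1 & H2 & H3) Hy. split; [trivial|]. split; [lra|].
  apply Rle_trans with (2 := H3). now apply M_decr.
Qed.

Lemma tail_eps (i : wave) (x : R) : tail i x -> eps i <= 1 /\ eps i * Q1 <= / 2.
Proof.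
  intros (H & _). assert (HQ := Q1_pos). unfold eps0 in H.
  assert (Hm : eps i * (1 + 2 * Q1) <= 1).
  { replace 1 with (/ (1 + 2 * Q1) * (1 + 2 * Q1)) at 2 by (field; lra).
    apply Rmult_le_compat_r; lra. }
  assert (He := eps_pos i). split; nra.
Qed.

Lemma dd_bounds (i : wave) : eps i <= 1 -> 0 <= dd i <= a0 + gamma ^ 2.
Proof.
  intros H. assert (He := eps_pos i). assert (Ha := a0_pos).
  assert (H2 := pow2_ge_0 gamma). unfold dd. nra.
Qed.

Lemma c2_bounds (i : wave) : eps i <= 1 -> 0 <= c2 i <= V ^ 2 + (a0 + gamma ^ 2).
Proof.
  intros H. assert (He := eps_pos i). assert (Hd := dd_bounds i H).
  assert (H2 := pow2_ge_0 V). unfold c2. nra.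
Qed.

Lemma q_bound (i : wave) (x : R) : tail i x -> Rabs (q i x) <= Q1.
Proof.
  intros Ht. destruct (tail_eps i x Ht) as [He _]. destruct Ht as (_ & Hx & HM).
  assert (Hc := c2_bounds i He). assert (Hd := dd_bounds i He).
  assert (HI := I0_bounds i x). assert (HM0 := M_pos i x).
  assert (Hr : Rabs (r i x) <= 3 * (V ^ 2 + (a0 + gamma ^ 2)) + sigma).
  { unfold r. assert (0 <= 1 + I0 i x + I0 i x ^ 2 <= 3) by nra.
    assert (0 <= c2 i * (1 + I0 i x + I0 i x ^ 2) <= (V ^ 2 + (a0 + gamma ^ 2)) * 3).
    { split; [apply Rmult_le_pos; lra | apply Rmult_le_compat; lra]. }
    apply Rabs_le. lra. }
  assert (HMr : Rabs (M i x * I0 i x * r i x)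
                <= K1 * (3 * (V ^ 2 + (a0 + gamma ^ 2)) + sigma)).
  { rewrite Rabs_mult. apply Rmult_le_compat; try apply Rabs_pos; trivial.
    rewrite Rabs_pos_eq by nra. nra. }
  unfold q, Q1. apply Rabs_le_between in HMr. apply Rabs_le. lra.
Qed.

Lemma h_bounds (i : wave) (x : R) : tail i x -> / 2 <= h i x <= 3 / 2.
Proof.
  intros Ht. assert (Hq := q_bound i x Ht). destruct (tail_eps i x Ht) as [_ He].
  assert (H0 := eps_pos i). rewrite h_eq. apply Rabs_le_between in Hq.
  assert (eps i * q i x <= eps i * Q1) by (apply Rmult_le_compat_l; lra).
  assert (eps i * - Q1 <= eps i * q i x) by (apply Rmult_le_compat_l; lra).
  lra.
Qed.

Lemma J_bounds (i : wave) (x : R) : tail i x -> 0 < J i x <= 2.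
Proof.
  intros Ht. assert (H := h_bounds i x Ht). unfold J. split.
  - apply Rinv_0_lt_compat; lra.
  - replace 2 with (/ / 2) by field. apply Rinv_le_contravar; lra.
Qed.

Lemma dM_eq (i : wave) (x : R) : tail i x -> dM i x = P i x * J i x.
Proof. intros Ht. assert (H := h_bounds i x Ht). rewrite P_eq. unfold J. field. lra. Qed.

(** [W' - M' = (h - 1) M'] is at most [|M'| / 2] in absolute value; integration from infinity
    compares [W - M] with [M / 2]. *)
Lemma W_M_bounds (i : wave) (x : R) :
  tail i x -> M i x / 2 <= W i x <= 3 / 2 * M i x.
Proof.
  intros Ht.
  assert (H : Rabs (W i x - M i x) <= M i x * / 2).
  { apply (dominated_at_infinity (fun t => W i t - M i t) (fun t => P i t - dM i t)
      (fun t => M i t * / 2) (fun t => dM i t * / 2) x); try lra.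
    - intros t _. apply (is_derive_minus (W i) (M i)); [apply W_derive | apply M_derive].
    - intros t _. apply is_derive_congr with (fun t => / 2 * M i t); [intros; ring|].
      rewrite Rmult_comm. apply is_derive_scal, M_derive.
    - intros t Hxt. assert (Htt := tail_later i x t Ht Hxt).
      assert (Hh := h_bounds i t Htt). assert (HM := dM_nonpos i t).
      destruct Htt as (_ & Ht0 & _). specialize (HM Ht0). rewrite P_eq.
      apply Rabs_le. nra.
    - replace 0 with (0 - 0) by ring.
      apply is_lim_minus'; [apply W_lim | apply M_lim].
    - apply (is_lim_ext (fun t => / 2 * M i t)); [intros; ring|].
      replace 0 with (/ 2 * 0) by ring. apply (is_lim_scal_l _ (/ 2) p_infty 0), M_lim. }
  apply Rabs_le_between in H. lra.
Qed.

Lemma W_bounds (i : wave) (x : R) : tail i x -> 0 < W i x <= 2 * K1.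
Proof.
  intros Ht. assert (H := W_M_bounds i x Ht). assert (HM := M_pos i x).
  destruct Ht as (_ & _ & HM'). lra.
Qed.

Lemma le_W_of_derive (i : wave) (f df : R -> R) (C x : R) :
  (forall t, x <= t -> is_derive f t (df t)) ->
  (forall t, x <= t -> Rabs (df t) <= C * - P i t) ->
  is_lim f p_infty 0 -> Rabs (f x) <= C * W i x.
Proof.
  intros Hf Hb Hl.
  apply (dominated_at_infinity f df (fun t => C * W i t) (fun t => C * P i t) x); trivial.
  - intros t _. apply is_derive_scal, W_derive.
  - intros t Ht. specialize (Hb t Ht). lra.
  - replace 0 with (C * 0) by ring. apply (is_lim_scal_l _ C p_infty 0), W_lim.
  - lra.
Qed.

Lemma Y_bound (i : wave) (x : R) : tail i x -> Rabs (Y i x) <= 2 * Q1 * W i x.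
Proof.
  intros Ht. apply le_W_of_derive with (df := fun t => dM i t * q i t).
  - intros; apply Y_derive.
  - intros t Hxt. assert (Htt := tail_later i x t Ht Hxt).
    assert (Hq := q_bound i t Htt). assert (HJ := J_bounds i t Htt).
    rewrite dM_eq by trivial. rewrite !Rabs_mult.
    destruct Htt as (_ & Ht0 & _). assert (HP := P_nonpos i t Ht0).
    rewrite (Rabs_left1 (P i t)), (Rabs_pos_eq (J i t)) by lra.
    replace (2 * Q1 * - P i t) with (- P i t * 2 * Q1) by ring.
    apply Rmult_le_compat; try apply Rabs_pos; trivial.
    + apply Rmult_le_pos; lra.
    + apply Rmult_le_compat_l; lra.
  - apply Y_lim.
Qed.

Lemma E1_bound (i : wave) (x : R) :
  tail i x -> Rabs (E1 i x) <= exp (2 * K1) * W i x.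
Proof.
  intros Ht. apply le_W_of_derive with (df := fun t => P i t * (1 + eps i * E1 i t)).
  - intros; apply E1_derive.
  - intros t Hxt. assert (Htt := tail_later i x t Ht Hxt).
    assert (HW := W_bounds i t Htt). destruct (tail_eps i t Htt) as [He _].
    assert (He0 := eps_pos i).
    destruct Htt as (_ & Ht0 & _). assert (HP := P_nonpos i t Ht0).
    (* Reading the factor as [exp (pot i t)], with [pot = eps W <= 2 K1], avoids a circular bound of
       [E1] in terms of itself. *)
    replace (1 + eps i * E1 i t) with (exp (pot i t)) by (unfold E1; field; lra).
    rewrite Rabs_mult, (Rabs_left1 (P i t)), (Rabs_pos_eq (exp _)), Rmult_comm;
      [| left; apply exp_pos | trivial].
    apply Rmult_le_compat_r; [lra|].
    assert (pot i t <= 2 * K1).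
    { replace (pot i t) with (eps i * W i t) by (unfold W; field; lra). nra. }
    destruct (Req_dec (pot i t) (2 * K1)) as [->|]; [lra|].
    left. apply exp_increasing. lra.
  - apply E1_lim.
Qed.

Lemma E2_bound (i : wave) (x : R) :
  tail i x -> Rabs (E2 i x) <= 2 * K1 * exp (2 * K1) * W i x.
Proof.
  intros Ht. apply le_W_of_derive with (df := fun t => P i t * E1 i t).
  - intros; apply E2_derive.
  - intros t Hxt. assert (Htt := tail_later i x t Ht Hxt).
    assert (HW := W_bounds i t Htt). assert (HE := E1_bound i t Htt).
    destruct Htt as (_ & Ht0 & _). assert (HP := P_nonpos i t Ht0).
    assert (Hx := exp_pos (2 * K1)).
    rewrite Rabs_mult, (Rabs_left1 (P i t)), Rmult_comm by trivial.
    apply Rmult_le_compat_r; [lra|]. nra.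
  - apply E2_lim.
Qed.

Lemma bounded_on_tail_param (f : wave -> R) (a b : R) :
  (forall i, eps i <= 1 -> a <= f i <= b) -> bounded_on tail (fun i _ => f i).
Proof.
  intros H. apply bounded_on_le with (Rmax (Rabs a) (Rabs b)).
  intros i x Ht. destruct (tail_eps i x Ht) as [He _]. specialize (H i He).
  apply Rabs_le. assert (X1 := Rmax_l (Rabs a) (Rabs b)).
  assert (X2 := Rmax_r (Rabs a) (Rabs b)).
  assert (X3 := Rle_abs (- a)). assert (X4 := Rle_abs b). rewrite Rabs_Ropp in X3. lra.
Qed.

Lemma bounded_on_tail_W (f : wave -> R -> R) (C : R) :
  0 <= C -> (forall i x, tail i x -> Rabs (f i x) <= C * W i x) -> bounded_on tail f.
Proof.
  intros HC H. apply bounded_on_le with (C * (2 * K1)). intros i x Ht.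
  apply Rle_trans with (1 := H i x Ht).
  assert (HW := W_bounds i x Ht). apply Rmult_le_compat_l; lra.
Qed.

Lemma rho_bounded : bounded_on tail rho.
Proof.
  assert (HK := K1_pos). assert (HQ := Q1_pos). assert (Hx := exp_pos (2 * K1)).
  assert (BE2 : bounded_on tail E2).
  { apply bounded_on_tail_W with (2 * K1 * exp (2 * K1)); [nra | apply E2_bound]. }
  assert (BY : bounded_on tail Y).
  { apply bounded_on_tail_W with (2 * Q1); [lra | apply Y_bound]. }
  assert (BM : bounded_on tail M).
  { apply bounded_on_le with K1. intros i x (_ & _ & H). assert (H0 := M_pos i x).
    rewrite Rabs_pos_eq; lra. }
  assert (BI : bounded_on tail I0).
  { apply bounded_on_le with 1. intros i x _. assert (H0 := I0_bounds i x).
    rewrite Rabs_pos_eq; lra. }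
  assert (BJ : bounded_on tail J).
  { apply bounded_on_le with 2. intros i x Ht. assert (H0 := J_bounds i x Ht).
    rewrite Rabs_pos_eq; lra. }
  assert (Bq : bounded_on tail q).
  { apply bounded_on_le with Q1. apply q_bound. }
  assert (Bd : bounded_on tail (fun i _ => dd i)).
  { apply bounded_on_tail_param with 0 (a0 + gamma ^ 2). apply dd_bounds. }
  assert (Bc : bounded_on tail (fun i _ => c2 i)).
  { apply bounded_on_tail_param with 0 (V ^ 2 + (a0 + gamma ^ 2)). apply c2_bounds. }
  assert (Br : bounded_on tail r).
  { unfold r. repeat first [assumption | apply bounded_on_const | apply bounded_on_minus
      | apply bounded_on_plus | apply bounded_on_pow | apply bounded_on_mult]. }
  unfold rho. repeat first [assumption | apply bounded_on_const | apply bounded_on_minus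
      | apply bounded_on_plus | apply bounded_on_pow | apply bounded_on_mult].
Qed.

Lemma err_bound :
  exists C, 0 < C /\ forall i x, tail i x -> Rabs (err i x) <= C * W i x.
Proof.
  destruct rho_bounded as [C [HC H]]. exists C. split; trivial. intros i x Ht.
  apply le_W_of_derive with (df := fun t => P i t * rho i t).
  - intros t Hxt. apply err_derive.
    assert (Hh := h_bounds i t (tail_later i x t Ht Hxt)). lra.
  - intros t Hxt. assert (Htt := tail_later i x t Ht Hxt). specialize (H i t Htt).
    destruct Htt as (_ & Ht0 & _). assert (HP := P_nonpos i t Ht0).
    rewrite Rabs_mult, (Rabs_left1 (P i t)), Rmult_comm by trivial.
    apply Rmult_le_compat_r; lra.
  - apply err_lim.
Qed.

(** * The approximate first integral and the amplitude bound *)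

Lemma P_derive_err (i : wave) (x : R) :
  is_derive (P i) x (a0 * W i x - V ^ 2 * W i x ^ 2 + eps i * err i x).
Proof.
  apply is_derive_eq with (1 := P_derive i x).
  assert (He := eps_pos i). unfold err. field. lra.
Qed.

(** Twice the mechanical energy of the limiting equation [W'' = a0 W - V^2 W^2], for which it is
    conserved and zero on the orbit homoclinic to the origin. *)
Definition energy (i : wave) (x : R) : R :=
  P i x ^ 2 - a0 * W i x ^ 2 + 2 / 3 * V ^ 2 * W i x ^ 3.

Lemma energy_derive (i : wave) (x : R) :
  is_derive (energy i) x (2 * eps i * err i x * P i x).
Proof.
  unfold energy.
  apply is_derive_eq with
    (2 * P i x * (a0 * W i x - V ^ 2 * W i x ^ 2 + eps i * err i x)
     - a0 * (2 * W i x * P i x) + 2 / 3 * V ^ 2 * (3 * W i x ^ 2 * P i x)); [|field].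
  apply (is_derive_plus (fun t => P i t ^ 2 - a0 * W i t ^ 2)
           (fun t => 2 / 3 * V ^ 2 * W i t ^ 3)).
  - apply (is_derive_minus (fun t => P i t ^ 2) (fun t => a0 * W i t ^ 2)).
    + apply is_derive_eq with (INR 2 * (a0 * W i x - V ^ 2 * W i x ^ 2 + eps i * err i x)
        * P i x ^ 1); [|simpl; ring].
      apply (is_derive_pow (P i) 2), P_derive_err.
    + apply is_derive_scal.
      apply is_derive_eq with (INR 2 * P i x * W i x ^ 1); [|simpl; ring].
      apply (is_derive_pow (W i) 2), W_derive.
  - apply is_derive_scal.
    apply is_derive_eq with (INR 3 * P i x * W i x ^ 2); [|simpl; ring].
    apply (is_derive_pow (W i) 3), W_derive.
Qed.

Lemma energy_lim (i : wave) : is_lim (energy i) p_infty 0.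
Proof.
  unfold energy. replace 0 with (0 - a0 * 0 + 2 / 3 * V ^ 2 * 0) by ring.
  apply is_lim_plus'.
  - apply is_lim_minus'.
    + replace 0 with (0 ^ 2) by ring.
      apply (is_lim_comp_continuous_at (P i) (fun y => y ^ 2)); [apply P_lim|].
      apply (ex_derive_continuous (fun y => y ^ 2) 0). auto_derive; trivial.
    + apply (is_lim_scal_l _ a0 p_infty 0), W_pow_lim.
  - apply (is_lim_scal_l _ (2 / 3 * V ^ 2) p_infty 0), W_pow_lim.
Qed.

(** With [|err| <= C W] the derivative is at most [2 eps C W (- P)], which is minus the derivative
    of [eps C W^2]; both sides vanish at infinity. The quadratic order in [W] is what later allows
    division by [W^2]. *)
Lemma energy_bound (C : R) (i : wave) (x : R) :
  (forall i x, tail i x -> Rabs (err i x) <= C * W i x) ->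
  tail i x -> Rabs (energy i x) <= eps i * C * W i x ^ 2.
Proof.
  intros HC Ht.
  apply (dominated_at_infinity (energy i) (fun t => 2 * eps i * err i t * P i t)
    (fun t => eps i * C * W i t ^ 2) (fun t => eps i * C * (2 * W i t * P i t)) x).
  - intros; apply energy_derive.
  - intros t _. apply is_derive_scal.
    apply is_derive_eq with (INR 2 * P i t * W i t ^ 1); [|simpl; ring].
    apply (is_derive_pow (W i) 2), W_derive.
  - intros t Hxt. assert (Htt := tail_later i x t Ht Hxt). specialize (HC i t Htt).
    destruct Htt as (_ & Ht0 & _). assert (HP := P_nonpos i t Ht0).
    assert (He := eps_pos i).
    rewrite !Rabs_mult, (Rabs_left1 (P i t)), (Rabs_pos_eq 2), (Rabs_pos_eq (eps i)) by lra.
    replace (- (eps i * C * (2 * W i t * P i t)))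
      with (2 * eps i * (C * W i t) * - P i t) by ring.
    apply Rmult_le_compat_r; [lra|]. apply Rmult_le_compat_l; lra.
  - apply energy_lim.
  - replace 0 with (eps i * C * 0) by ring.
    apply (is_lim_scal_l _ (eps i * C) p_infty 0), W_pow_lim.
  - lra.
Qed.

(* A wave with [M > K1] somewhere would cross the level [K1], where [W] is so large
   that the first integral forces [P^2 < 0]. *)
Lemma tail_all :
  exists e1, 0 < e1 /\ forall i x, eps i < e1 -> 0 <= x -> tail i x.
Proof.
  destruct err_bound as [C [HC Herr]].
  assert (HV := V_pos).
  exists (Rmin eps0 (V * gamma / (2 * C))). split.
  { apply Rmin_pos; [apply eps0_pos|]. apply Rdiv_lt_0_compat; nra. }
  intros i x He Hx.
  assert (He0 : eps i <= eps0) by (generalize (Rmin_l eps0 (V * gamma / (2 * C))); lra).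
  assert (HeC : eps i * C <= V * gamma / 2).
  { replace (V * gamma / 2) with (V * gamma / (2 * C) * C) by (field; lra).
    apply Rmult_le_compat_r; [lra|].
    generalize (Rmin_r eps0 (V * gamma / (2 * C))); lra. }
  split; [trivial|]. split; [trivial|].
  apply Rnot_lt_le. intros Hlt.
  assert (HK := K1_pos).
  destruct (proj1 (is_lim_p_infty_ball _ _) (M_lim i) K1 HK) as [A HA].
  set (b := Rmax (A + 1) (x + 1)).
  assert (Hb1 := Rmax_l (A + 1) (x + 1)). assert (Hb2 := Rmax_r (A + 1) (x + 1)).
  fold b in Hb1, Hb2.
  specialize (HA b ltac:(lra)). rewrite Rminus_0_r in HA. apply Rabs_def2 in HA.
  destruct (IVT_gen (M i) x b K1) as [t [Ht Et]].
  { intros t. apply is_derive_continuity_pt with (dM i t). apply M_derive. }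
  { rewrite Rmin_right, Rmax_left by lra. lra. }
  rewrite Rmin_left, Rmax_right in Ht by lra.
  assert (Htt : tail i t) by (split; [trivial|]; split; [lra|]; lra).
  assert (HE := energy_bound C i t Herr Htt).
  assert (HW := W_M_bounds i t Htt). rewrite Et in HW.
  assert (HK' : V * K1 = 8 * gamma) by (unfold K1; field; lra).
  apply Rabs_le_between in HE. unfold energy in HE.
  assert (HP := pow2_ge_0 (P i t)).
  (* At the crossing [2/3 V^2 W^3 >= 8/3 V gamma W^2], while [a0 = 2 V gamma] and
     [eps C <= V gamma / 2]. Hence [P^2 <= (1/2 + 2 - 8/3) V gamma W^2 < 0], which explains the
     threshold on [eps]. *)
  assert (H4 : 4 * gamma <= V * W i t) by nra.
  assert (H5 : 2 / 3 * V * (4 * gamma) * W i t ^ 2 <= 2 / 3 * V ^ 2 * W i t ^ 3).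
  { replace (2 / 3 * V ^ 2 * W i t ^ 3) with (2 / 3 * V * (V * W i t) * W i t ^ 2) by ring.
    apply Rmult_le_compat_r; [apply pow2_ge_0|]. apply Rmult_le_compat_l; lra. }
  assert (H6 : 0 < W i t ^ 2) by (apply pow_lt; lra).
  assert (H7 : eps i * C * W i t ^ 2 <= V * gamma / 2 * W i t ^ 2)
    by (apply Rmult_le_compat_r; lra).
  assert (H8 : 0 < V * gamma * W i t ^ 2).
  { apply Rmult_lt_0_compat; [apply Rmult_lt_0_compat|]; lra. }
  unfold a0 in HE. lra.
Qed.


(** * Comparison with the KdV profile *)

Definition kap : R := sqrt a0.

Lemma kap_pos : 0 < kap.
Proof. apply sqrt_lt_R0, a0_pos. Qed.

Lemma kap_sqr : kap ^ 2 = a0.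
Proof. unfold kap. rewrite <- Rsqr_pow2. apply Rsqr_sqrt. left. apply a0_pos. Qed.

Lemma KdV_rate : sqrt (V * gamma / 2) = kap / 2.
Proof.
  assert (Hk := kap_pos). assert (HV := V_pos).
  replace (V * gamma / 2) with ((kap / 2) ^ 2).
  - apply sqrt_pow2. lra.
  - replace ((kap / 2) ^ 2) with (kap ^ 2 / 4) by field. rewrite kap_sqr. unfold a0. field.
Qed.

Local Notation v := (n_KdV sigma gamma).

Definition inv_KdV (x : R) : R := V / (3 * gamma) * cosh (kap / 2 * x) ^ 2.
Definition dinv_KdV (x : R) : R :=
  V / (3 * gamma) * (kap * cosh (kap / 2 * x) * sinh (kap / 2 * x)).

Lemma cosh_pos (x : R) : 0 < cosh x.
Proof. unfold cosh. assert (H1 := exp_pos x). assert (H2 := exp_pos (- x)). lra. Qed.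

Lemma v_inv (x : R) : v x = / inv_KdV x.
Proof.
  assert (HV := V_pos). assert (Hc := cosh_pos (kap / 2 * x)).
  unfold n_KdV, inv_KdV, sech. rewrite KdV_rate. field. lra.
Qed.

Lemma inv_KdV_pos (x : R) : 0 < inv_KdV x.
Proof.
  unfold inv_KdV. apply Rmult_lt_0_compat.
  - apply Rdiv_lt_0_compat; [apply V_pos | lra].
  - apply pow_lt, cosh_pos.
Qed.

Lemma is_derive_cosh_lin (a x : R) :
  is_derive (fun t => cosh (a * t)) x (a * sinh (a * x)).
Proof.
  apply (is_derive_comp cosh (fun t => a * t)).
  - apply is_derive_Reals, derivable_pt_lim_cosh.
  - auto_derive; trivial; ring.
Qed.

Lemma is_derive_sinh_lin (a x : R) :
  is_derive (fun t => sinh (a * t)) x (a * cosh (a * x)).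
Proof.
  apply (is_derive_comp sinh (fun t => a * t)).
  - apply is_derive_Reals, derivable_pt_lim_sinh.
  - auto_derive; trivial; ring.
Qed.

Lemma cosh_sqr_minus (x : R) : cosh x ^ 2 - sinh x ^ 2 = 1.
Proof.
  unfold cosh, sinh.
  replace (((exp x + exp (- x)) / 2) ^ 2 - ((exp x - exp (- x)) / 2) ^ 2)
    with (exp x * exp (- x)) by field.
  rewrite <- exp_plus. replace (x + - x) with 0 by ring. apply exp_0.
Qed.

Lemma inv_KdV_derive (x : R) : is_derive inv_KdV x (dinv_KdV x).
Proof.
  unfold inv_KdV, dinv_KdV. apply is_derive_scal.
  apply is_derive_eq with
    (INR 2 * (kap / 2 * sinh (kap / 2 * x)) * cosh (kap / 2 * x) ^ 1); [|simpl; field].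
  apply (is_derive_pow (fun t => cosh (kap / 2 * t)) 2), is_derive_cosh_lin.
Qed.

Lemma dinv_KdV_derive (x : R) :
  is_derive dinv_KdV x (a0 * inv_KdV x - V ^ 2 / 3).
Proof.
  assert (HV := V_pos). unfold dinv_KdV, inv_KdV.
  apply is_derive_eq with (V / (3 * gamma) *
    (kap * (kap / 2 * sinh (kap / 2 * x)) * sinh (kap / 2 * x)
     + kap * cosh (kap / 2 * x) * (kap / 2 * cosh (kap / 2 * x)))).
  - apply is_derive_scal.
    apply (is_derive_mult (fun t => kap * cosh (kap / 2 * t)) (fun t => sinh (kap / 2 * t))).
    + apply is_derive_scal, is_derive_cosh_lin.
    + apply is_derive_sinh_lin.
    + intros; apply Rmult_comm.
  - assert (H := cosh_sqr_minus (kap / 2 * x)).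
    replace (kap * (kap / 2 * sinh (kap / 2 * x)) * sinh (kap / 2 * x)
      + kap * cosh (kap / 2 * x) * (kap / 2 * cosh (kap / 2 * x)))
      with (kap ^ 2 * (cosh (kap / 2 * x) ^ 2 + sinh (kap / 2 * x) ^ 2) / 2) by field.
    replace (sinh (kap / 2 * x) ^ 2) with (cosh (kap / 2 * x) ^ 2 - 1) by lra.
    rewrite kap_sqr. unfold a0. field. lra.
Qed.

Lemma v_pos (x : R) : 0 < v x.
Proof. rewrite v_inv. apply Rinv_0_lt_compat, inv_KdV_pos. Qed.

(** The factor 12 is the amplitude factor 3 times the 4 of [cosh y ^ 2 >= exp (2 * y) / 4]. *)
Lemma v_decay (x : R) : v x <= 12 * gamma / V * exp (- kap * x).
Proof.
  assert (HV := V_pos). rewrite v_inv.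
  assert (He : exp (- kap * x) = / exp (kap * x))
    by (rewrite <- exp_Ropp; f_equal; ring).
  assert (Hp := exp_pos (kap * x)).
  replace (12 * gamma / V * exp (- kap * x)) with (/ (V / (12 * gamma) * exp (kap * x)))
    by (rewrite He; field; lra).
  apply Rinv_le_contravar.
  - apply Rmult_lt_0_compat; trivial. apply Rdiv_lt_0_compat; lra.
  - unfold inv_KdV.
    replace (V / (12 * gamma) * exp (kap * x)) with
      (V / (3 * gamma) * (exp (kap * x) / 4)) by (field; lra).
    apply Rmult_le_compat_l; [left; apply Rdiv_lt_0_compat; lra|].
    replace (kap * x) with (kap / 2 * x + kap / 2 * x) by field. rewrite exp_plus.
    unfold cosh. assert (H1 := exp_pos (kap / 2 * x)).
    assert (H2 := exp_pos (- (kap / 2 * x))). nra.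
Qed.

(** * The reciprocal of the wave and its distance to the reciprocal profile *)

Lemma P_0 (i : wave) : P i 0 = 0.
Proof.
  unfold P. rewrite derive_even_0; [unfold Rdiv; ring | apply pot_even | apply pot_smooth].
Qed.

Definition Z (i : wave) (x : R) : R := / W i x.
Definition dZ (i : wave) (x : R) : R := - P i x * Z i x ^ 2.
(** The forcing in the equation of [Z]: in [- P' Z^2 + 2 P^2 Z^3] the second derivative is replaced
    through [err] and [P^2] through [energy]. The explicit terms give
    [(2 - 1) a0 Z + (1 - 4/3) V^2], and the rest is collected here. *)
Definition gZ (i : wave) (x : R) : R :=
  - eps i * err i x * Z i x ^ 2 + 2 * energy i x * Z i x ^ 3.

Lemma Z_derive (i : wave) (x : R) : tail i x -> is_derive (Z i) x (dZ i x).
Proof.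
  intros Ht. assert (HW := W_bounds i x Ht).
  apply is_derive_eq with (- P i x / W i x ^ 2).
  - apply is_derive_inv; [apply W_derive | lra].
  - unfold dZ, Z. field. lra.
Qed.

Lemma dZ_derive (i : wave) (x : R) :
  tail i x -> is_derive (dZ i) x (a0 * Z i x - V ^ 2 / 3 + gZ i x).
Proof.
  intros Ht. assert (HW := W_bounds i x Ht).
  apply is_derive_eq with
    (- (a0 * W i x - V ^ 2 * W i x ^ 2 + eps i * err i x) * Z i x ^ 2
     + - P i x * (INR 2 * dZ i x * Z i x ^ 1)).
  - apply (is_derive_mult (fun t => - P i t) (fun t => Z i t ^ 2)).
    + apply (is_derive_opp (P i)), P_derive_err.
    + apply (is_derive_pow (Z i) 2). now apply Z_derive.
    + intros; apply Rmult_comm.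
  - unfold gZ, dZ, energy, Z. simpl. field. lra.
Qed.

Lemma exp_le (x y : R) : x <= y -> exp x <= exp y.
Proof. intros [H| ->]; [left; now apply exp_increasing | right; trivial]. Qed.

Section FixedWave.

(** The 14 comes from [W_decay]: there errors of total size [(1/2 + 3) eps C Z] must fit into the
    margin [a0 Z / 4] between [a0 / 2] and [(kap / 2)^2]. *)
Context (C : R) (i : wave) (HC : 0 < C)
  (Herr : forall i x, tail i x -> Rabs (err i x) <= C * W i x)
  (Htail : forall x, 0 <= x -> tail i x)
  (Hsmall : eps i * C <= a0 / 14).

Lemma W_pos (x : R) : 0 <= x -> 0 < W i x.
Proof. intros Hx. apply (W_bounds i x (Htail x Hx)). Qed.

Lemma W_decr (x : R) : 0 <= x -> W i x <= W i 0.
Proof.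
  intros Hx. cut (- W i 0 <= - W i x); [lra|].
  apply derive_nonneg_le with (f := fun t => - W i t) (df := fun t => - P i t); trivial;
    intros t Ht.
  - apply (is_derive_opp (W i)), W_derive.
  - assert (H := P_nonpos i t ltac:(lra)). lra.
Qed.

(** At the crest [P = 0], so the energy factors as [(2/3 V^2 W - a0) W^2], and [W^2] cancels from
    its bound. *)
Lemma W_0_bound : Rabs (2 / 3 * V ^ 2 * W i 0 - a0) <= eps i * C.
Proof.
  assert (H0 := Rle_refl 0).
  assert (HE := energy_bound C i 0 Herr (Htail 0 H0)). assert (HW := W_pos 0 H0).
  unfold energy in HE. rewrite P_0 in HE.
  replace (0 ^ 2 - a0 * W i 0 ^ 2 + 2 / 3 * V ^ 2 * W i 0 ^ 3)
    with ((2 / 3 * V ^ 2 * W i 0 - a0) * W i 0 ^ 2) in HE by ring.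
  assert (H2 : 0 < W i 0 ^ 2) by (apply pow_lt; lra).
  rewrite Rabs_mult, (Rabs_pos_eq (W i 0 ^ 2)) in HE by lra.
  now apply Rmult_le_reg_r with (W i 0 ^ 2).
Qed.

(** Half of the KdV amplitude. It excludes waves of vanishing rescaled height and so bounds [Z] at
    the crest uniformly. *)
Lemma W_0_lower : 3 * gamma / (2 * V) <= W i 0.
Proof.
  assert (H := W_0_bound). assert (HV := V_pos). assert (Ha := a0_pos).
  apply Rabs_le_between in H.
  apply Rmult_le_reg_l with (2 / 3 * V ^ 2); [nra|].
  replace (2 / 3 * V ^ 2 * (3 * gamma / (2 * V))) with (a0 / 2) by (unfold a0; field; lra).
  lra.
Qed.

Lemma Z_pos (x : R) : 0 <= x -> 0 < Z i x.
Proof. intros Hx. apply Rinv_0_lt_compat. now apply W_pos. Qed.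

Lemma Z_0_upper : Z i 0 <= 2 * V / (3 * gamma).
Proof.
  assert (H := W_0_lower). assert (HV := V_pos).
  replace (2 * V / (3 * gamma)) with (/ (3 * gamma / (2 * V))) by (field; lra).
  apply Rinv_le_contravar; trivial. apply Rdiv_lt_0_compat; lra.
Qed.

Lemma gZ_bound (x : R) : 0 <= x -> Rabs (gZ i x) <= 3 * (eps i * C) * Z i x.
Proof.
  intros Hx. assert (Ht := Htail x Hx). assert (HW := W_pos x Hx).
  assert (HE := energy_bound C i x Herr Ht). assert (Hr := Herr i x Ht).
  assert (He := eps_pos i). assert (HZ := Z_pos x Hx).
  assert (HZW : Z i x * W i x = 1) by (unfold Z; field; lra).
  unfold gZ. apply Rle_trans with (1 := Rabs_triang _ _).
  rewrite !Rabs_mult, Rabs_Ropp, (Rabs_pos_eq (eps i)), (Rabs_pos_eq 2),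
    (Rabs_pos_eq (Z i x ^ 2)), (Rabs_pos_eq (Z i x ^ 3)) by (try apply pow_le; lra).
  assert (HZ2 : 0 < Z i x ^ 2) by (apply pow_lt; lra).
  assert (HZ3 : 0 < Z i x ^ 3) by (apply pow_lt; lra).
  apply Rle_trans with (eps i * (C * W i x) * Z i x ^ 2
                        + 2 * (eps i * C * W i x ^ 2) * Z i x ^ 3).
  - apply Rplus_le_compat; apply Rmult_le_compat_r; try lra.
    apply Rmult_le_compat_l; lra.
  - right.
    replace (eps i * (C * W i x) * Z i x ^ 2)
      with (eps i * C * (Z i x * W i x) * Z i x) by ring.
    replace (2 * (eps i * C * W i x ^ 2) * Z i x ^ 3)
      with (2 * (eps i * C) * (Z i x * W i x) ^ 2 * Z i x) by ring.
    rewrite HZW. ring.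
Qed.

(** The cubic term of the energy has the favourable sign, leaving [P^2 <= (1 + 1/14) a0 W^2], and
    [1 + 1/14 <= (9/8)^2]. A rate above [kap] independent of [eps] is what [linear_ode_growth]
    requires later. *)
Lemma P_bound (x : R) : 0 <= x -> Rabs (P i x) <= 9 / 8 * kap * W i x.
Proof.
  intros Hx. assert (HE := energy_bound C i x Herr (Htail x Hx)).
  assert (HW := W_pos x Hx). assert (Hk := kap_pos). assert (Ha := a0_pos).
  assert (HV := pow2_ge_0 V).
  assert (HP : P i x ^ 2 <= (9 / 8 * kap * W i x) ^ 2).
  { replace ((9 / 8 * kap * W i x) ^ 2) with (81 / 64 * kap ^ 2 * W i x ^ 2) by field.
    rewrite kap_sqr. apply Rabs_le_between in HE. unfold energy in HE.
    assert (0 <= W i x ^ 2) by apply pow2_ge_0.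
    assert (0 <= W i x ^ 3) by (apply pow_le; lra).
    assert (0 <= V ^ 2 * W i x ^ 3) by (apply Rmult_le_pos; trivial).
    assert (eps i * C * W i x ^ 2 <= a0 / 14 * W i x ^ 2) by (apply Rmult_le_compat_r; trivial).
    assert (0 <= a0 * W i x ^ 2) by (apply Rmult_le_pos; lra).
    lra. }
  rewrite <- !Rsqr_pow2 in HP.
  rewrite <- (Rabs_pos_eq (9 / 8 * kap * W i x)) by (apply Rmult_le_pos; lra).
  now apply Rsqr_le_abs_0.
Qed.

(** Gronwall: [P_bound] reads [Z' <= 9/8 kap Z], and [Z 0] is controlled by the crest. *)
Lemma Z_upper (x : R) :
  0 <= x -> Z i x <= 2 * V / (3 * gamma) * exp (9 / 8 * kap * x).
Proof.
  intros Hx.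
  assert (H : - (Z i 0 * exp (- (9 / 8 * kap) * 0))
              <= - (Z i x * exp (- (9 / 8 * kap) * x))).
  { apply derive_nonneg_le with (f := fun t => - (Z i t * exp (- (9 / 8 * kap) * t)))
      (df := fun t => - ((dZ i t - 9 / 8 * kap * Z i t) * exp (- (9 / 8 * kap) * t))); trivial;
      intros t Ht.
    - apply (is_derive_opp (fun t => Z i t * exp (- (9 / 8 * kap) * t))).
      apply is_derive_eq with (dZ i t * exp (- (9 / 8 * kap) * t)
        + Z i t * (- (9 / 8 * kap) * exp (- (9 / 8 * kap) * t))); [|ring].
      apply (is_derive_mult (Z i) (fun t => exp (- (9 / 8 * kap) * t))).
      + apply Z_derive, Htail; lra.
      + auto_derive; trivial; ring.
      + intros; apply Rmult_comm.
    - assert (HP := P_bound t ltac:(lra)). assert (HW := W_pos t ltac:(lra)).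
      assert (HZ := Z_pos t ltac:(lra)).
      assert (HZW : Z i t * W i t = 1) by (unfold Z; field; lra).
      apply Rabs_le_between in HP.
      assert (dZ i t <= 9 / 8 * kap * Z i t).
      { unfold dZ. replace (9 / 8 * kap * Z i t)
          with (9 / 8 * kap * (Z i t * W i t) * Z i t) by (rewrite HZW; ring).
        replace (9 / 8 * kap * (Z i t * W i t) * Z i t)
          with (9 / 8 * kap * W i t * Z i t ^ 2) by ring.
        apply Rmult_le_compat_r; [apply pow2_ge_0 | lra]. }
      assert (He := exp_pos (- (9 / 8 * kap) * t)). nra. }
  rewrite Rmult_0_r, exp_0, Rmult_1_r in H.
  assert (E : exp (- (9 / 8 * kap) * x) * exp (9 / 8 * kap * x) = 1).
  { rewrite <- exp_plus. replace (- (9 / 8 * kap) * x + 9 / 8 * kap * x) with 0 by ring.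
    apply exp_0. }
  assert (He := exp_pos (9 / 8 * kap * x)). assert (H0 := Z_0_upper).
  replace (Z i x) with (Z i x * exp (- (9 / 8 * kap) * x) * exp (9 / 8 * kap * x))
    by (rewrite Rmult_assoc, E; ring).
  apply Rmult_le_compat_r; lra.
Qed.

(** Half the true rate, because the constant [- V^2 / 3] in the equation of [Z] has to be absorbed
    into the linear term already near the crest, where [Z] is smallest. The factor [4 K1] is twice
    the bound [2 K1] on [W 0], from the halving in [convex_growth]. *)
Lemma W_decay (x : R) : 0 <= x -> W i x <= 4 * K1 * exp (- (kap / 2) * x).
Proof.
  intros Hx. assert (Hk := kap_pos).
  assert (H : Z i 0 / 2 * exp (kap / 2 * x) <= Z i x).
  { apply (convex_growth (Z i) (dZ i) (fun t => a0 * Z i t - V ^ 2 / 3 + gZ i t));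
      trivial; try lra.
    - intros t Ht. now apply Z_derive, Htail.
    - intros t Ht. now apply dZ_derive, Htail.
    - intros t Ht. assert (HZ := Z_pos t Ht). assert (Hg := gZ_bound t Ht).
      assert (HW := W_pos t Ht). assert (HWd := W_decr t Ht). assert (H0 := W_0_bound).
      apply Rabs_le_between in Hg, H0.
      assert (HZW : Z i t * W i t = 1) by (unfold Z; field; lra).
      assert (HV2 := pow2_ge_0 V).
      (* The constant is turned into a multiple of [Z] through [1 = W Z <= W 0 * Z]; the crest
         identity then bounds it by about [a0 / 2 * Z]. *)
      assert (X : V ^ 2 / 3 <= V ^ 2 / 3 * W i 0 * Z i t).
      { rewrite Rmult_assoc. rewrite <- (Rmult_1_r (V ^ 2 / 3)) at 1.
        apply Rmult_le_compat_l; [lra|]. rewrite <- HZW, Rmult_comm.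
        apply Rmult_le_compat_r; lra. }
      assert (X2 : V ^ 2 / 3 * W i 0 * Z i t <= (a0 / 2 + eps i * C / 2) * Z i t)
        by (apply Rmult_le_compat_r; lra).
      assert (X3 : eps i * C * Z i t <= a0 / 14 * Z i t) by (apply Rmult_le_compat_r; lra).
      replace ((kap / 2) ^ 2) with (kap ^ 2 / 4) by field. rewrite kap_sqr. lra.
    - apply Z_pos; lra.
    - unfold dZ. rewrite P_0. ring. }
  assert (He := exp_pos (kap / 2 * x)). assert (HW0 := W_bounds i 0 (Htail 0 (Rle_refl 0))).
  assert (HW := W_pos x Hx).
  assert (H1 : / (2 * (2 * K1)) * exp (kap / 2 * x) <= Z i x).
  { apply Rle_trans with (2 := H). apply Rmult_le_compat_r; [lra|].
    unfold Z. replace (/ W i 0 / 2) with (/ (2 * W i 0)) by (field; lra).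
    apply Rinv_le_contravar; lra. }
  replace (W i x) with (/ Z i x) by (unfold Z; field; lra).
  replace (4 * K1 * exp (- (kap / 2) * x)) with (/ (/ (2 * (2 * K1)) * exp (kap / 2 * x))).
  - apply Rinv_le_contravar; trivial. apply Rmult_lt_0_compat; trivial.
    apply Rinv_0_lt_compat; lra.
  - replace (- (kap / 2) * x) with (- (kap / 2 * x)) by ring. rewrite exp_Ropp. field. lra.
Qed.

(** The first summand is the size of the forcing, [3 C] times the constant of [Z_upper]; the second
    majorises the initial data of both first-order problems, [d] and [d' + kap d] at 0 for
    [d = Z - inv_KdV]. *)
Definition Kd : R := 2 * C * V / gamma + C / (3 * gamma ^ 2) * (1 + kap).

Lemma Kd_pos : 0 < Kd.
Proof.
  assert (HV := V_pos). assert (Hk := kap_pos). unfold Kd.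
  apply Rplus_lt_0_compat.
  - apply Rdiv_lt_0_compat; trivial. nra.
  - apply Rmult_lt_0_compat; [|lra]. apply Rdiv_lt_0_compat; trivial. nra.
Qed.

Lemma Z_KdV_0 : Rabs (Z i 0 - inv_KdV 0) <= eps i * (C / (3 * gamma ^ 2)).
Proof.
  assert (HV := V_pos). assert (HW := W_0_lower). assert (H := W_0_bound).
  assert (Hp := W_pos 0 (Rle_refl 0)). assert (He := eps_pos i).
  replace (Z i 0 - inv_KdV 0)
    with (- (2 / 3 * V ^ 2 * W i 0 - a0) * / (2 * V * gamma * W i 0)).
  - rewrite Rabs_mult, Rabs_Ropp.
    replace (eps i * (C / (3 * gamma ^ 2)))
      with (eps i * C * / (2 * V * gamma * (3 * gamma / (2 * V)))) by (field; lra).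
    assert (X : 0 < 2 * V * gamma) by nra.
    assert (X' : 0 < 3 * gamma / (2 * V)) by (apply Rdiv_lt_0_compat; lra).
    apply Rmult_le_compat; try apply Rabs_pos; trivial.
    rewrite Rabs_pos_eq by (left; apply Rinv_0_lt_compat, Rmult_lt_0_compat; trivial).
    apply Rinv_le_contravar; [now apply Rmult_lt_0_compat|].
    apply Rmult_le_compat_l; lra.
  - unfold Z, inv_KdV, a0. rewrite Rmult_0_r, cosh_0. field. lra.
Qed.

(** The difference [d] satisfies [d'' = kap^2 d + gZ] with [d' 0 = 0]. Solving first for
    [d' + kap d] ([mu = kap]) and then for [d] ([mu = - kap]) costs one factor each; [8 / kap] is
    the inverse of the gap [9/8 kap - kap] and also majorises the inverse of the larger second
    gap. *)
Lemma Z_KdV_bound (x : R) : 0 <= x ->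
  Rabs (Z i x - inv_KdV x)
  <= eps i * (Kd * (1 + 8 / kap) ^ 2) * exp (9 / 8 * kap * x).
Proof.
  intros Hx. assert (HV := V_pos). assert (Hk := kap_pos). assert (HK := Kd_pos).
  assert (He := eps_pos i). assert (H0 := Z_KdV_0).
  set (d := fun t => Z i t - inv_KdV t). set (d' := fun t => dZ i t - dinv_KdV t).
  assert (Hd' : d' 0 = 0).
  { unfold d', dZ, dinv_KdV. rewrite P_0, Rmult_0_r, sinh_0. ring. }
  assert (HeK : 0 < eps i * Kd) by (apply Rmult_lt_0_compat; trivial).
  assert (Hq : 0 < C / (3 * gamma ^ 2)) by (apply Rdiv_lt_0_compat; nra).
  assert (Hq2 : 0 < 2 * C * V / gamma) by (apply Rdiv_lt_0_compat; nra).
  assert (H8 : 0 < 8 / kap) by (apply Rdiv_lt_0_compat; lra).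
  assert (E8 : / (9 / 8 * kap - kap) = 8 / kap) by (field; lra).
  assert (Hs : forall t, 0 <= t -> Rabs (d' t + kap * d t)
                 <= eps i * Kd * (1 + 8 / kap) * exp (9 / 8 * kap * t)).
  { rewrite <- E8. intros t Ht.
    apply (linear_ode_growth (fun t => d' t + kap * d t) (gZ i)); trivial; try lra.
    - intros s Hs. apply is_derive_eq with
        (a0 * Z i s - V ^ 2 / 3 + gZ i s - (a0 * inv_KdV s - V ^ 2 / 3)
         + kap * (dZ i s - dinv_KdV s)).
      + apply (is_derive_plus d' (fun t => kap * d t)).
        * apply (is_derive_minus (dZ i) dinv_KdV);
            [now apply dZ_derive, Htail | apply dinv_KdV_derive].
        * apply is_derive_scal, (is_derive_minus (Z i) inv_KdV);
            [now apply Z_derive, Htail | apply inv_KdV_derive].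
      + unfold d', d. rewrite <- kap_sqr. ring.
    - intros s Hs. assert (Hg := gZ_bound s Hs). assert (HZ := Z_upper s Hs).
      apply Rle_trans with (1 := Hg).
      apply Rle_trans with
        (3 * (eps i * C) * (2 * V / (3 * gamma) * exp (9 / 8 * kap * s))).
      + apply Rmult_le_compat_l; trivial. nra.
      + replace (3 * (eps i * C) * (2 * V / (3 * gamma) * exp (9 / 8 * kap * s)))
          with (eps i * (2 * C * V / gamma) * exp (9 / 8 * kap * s)) by (field; lra).
        apply Rmult_le_compat_r; [left; apply exp_pos|].
        apply Rmult_le_compat_l; [lra|]. unfold Kd. nra.
    - rewrite Hd', Rplus_0_l, Rabs_mult, (Rabs_pos_eq kap) by lra. unfold d.
      apply Rle_trans with (kap * (eps i * (C / (3 * gamma ^ 2)))).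
      + apply Rmult_le_compat_l; lra.
      + replace (kap * (eps i * (C / (3 * gamma ^ 2))))
          with (eps i * (C / (3 * gamma ^ 2) * kap)) by ring.
        apply Rmult_le_compat_l; [lra|]. unfold Kd. nra. }
  set (K := eps i * Kd * (1 + 8 / kap)).
  assert (HKK : 0 < K) by (apply Rmult_lt_0_compat; lra).
  assert (H : Rabs (d x) <= K * (1 + / (9 / 8 * kap - - kap)) * exp (9 / 8 * kap * x)).
  { apply (linear_ode_growth d (fun t => d' t + kap * d t)); trivial; try lra.
    - intros t Ht. apply is_derive_eq with (dZ i t - dinv_KdV t).
      + apply (is_derive_minus (Z i) inv_KdV);
          [now apply Z_derive, Htail | apply inv_KdV_derive].
      + unfold d'. ring.
    - apply Rle_trans with (1 := H0). unfold K. rewrite Rmult_assoc.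
      apply Rmult_le_compat_l; [lra|].
      apply Rle_trans with (C / (3 * gamma ^ 2) * (1 + kap)); [nra|].
      rewrite <- (Rmult_1_r (C / (3 * gamma ^ 2) * (1 + kap))).
      apply Rmult_le_compat; try lra; [nra|]. unfold Kd. lra. }
  apply Rle_trans with (1 := H). apply Rmult_le_compat_r; [left; apply exp_pos|].
  replace (eps i * (Kd * (1 + 8 / kap) ^ 2)) with (K * (1 + 8 / kap)) by (unfold K; ring).
  apply Rmult_le_compat_l; [lra|]. apply Rplus_le_compat_l. rewrite <- E8.
  apply Rinv_le_contravar; lra.
Qed.

(** [W - v = - (Z - 1/v) W v]: the two decaying factors outweigh the growth of the difference, since
    9/8 - 1/2 - 1 = -3/8 is below -1/4. *)
Lemma W_KdV_bound (x : R) : 0 <= x ->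
  Rabs (W i x - v x)
  <= eps i * (Kd * (1 + 8 / kap) ^ 2 * (4 * K1) * (12 * gamma / V)) * exp (- (kap / 4) * x).
Proof.
  intros Hx. assert (HW := W_pos x Hx). assert (Hv := v_pos x).
  assert (Hi := inv_KdV_pos x). assert (H := Z_KdV_bound x Hx).
  assert (HWd := W_decay x Hx). assert (Hvd := v_decay x).
  assert (Hk := kap_pos). assert (HK := Kd_pos). assert (He := eps_pos i).
  assert (HK1 := K1_pos). assert (HV := V_pos).
  replace (W i x - v x) with (- (Z i x - inv_KdV x) * W i x * v x)
    by (rewrite v_inv; unfold Z; field; lra).
  rewrite !Rabs_mult, Rabs_Ropp, (Rabs_pos_eq (W i x)), (Rabs_pos_eq (v x)) by lra.
  apply Rle_trans with
    (eps i * (Kd * (1 + 8 / kap) ^ 2) * exp (9 / 8 * kap * x)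
     * (4 * K1 * exp (- (kap / 2) * x)) * (12 * gamma / V * exp (- kap * x))).
  - apply Rmult_le_compat; trivial; try lra.
    + apply Rmult_le_pos; [apply Rabs_pos | lra].
    + apply Rmult_le_compat; trivial; [apply Rabs_pos | lra].
  - replace (eps i * (Kd * (1 + 8 / kap) ^ 2) * exp (9 / 8 * kap * x)
     * (4 * K1 * exp (- (kap / 2) * x)) * (12 * gamma / V * exp (- kap * x)))
     with (eps i * (Kd * (1 + 8 / kap) ^ 2 * (4 * K1) * (12 * gamma / V)) *
       (exp (9 / 8 * kap * x) * exp (- (kap / 2) * x) * exp (- kap * x))) by ring.
    apply Rmult_le_compat_l.
    + assert (0 < 8 / kap) by (apply Rdiv_lt_0_compat; lra).
      assert (0 < 12 * gamma / V) by (apply Rdiv_lt_0_compat; lra).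
      assert (0 <= (1 + 8 / kap) ^ 2) by apply pow2_ge_0.
      repeat first [lra | apply Rmult_le_pos].
    + rewrite <- !exp_plus. apply exp_le. nra.
Qed.

End FixedWave.

Lemma profile_bounds :
  exists e1 C, 0 < e1 /\ 0 < C /\ e1 <= 1 /\ forall i, eps i < e1 -> forall x, 0 <= x ->
    tail i x /\ W i x <= C * exp (- (kap / 4) * x) /\
    Rabs (P i x) <= C * W i x /\ Rabs (err i x) <= C * W i x /\
    Rabs (W i x - v x) <= eps i * C * exp (- (kap / 4) * x).
Proof.
  destruct tail_all as [e1 [He1 Ht]]. destruct err_bound as [C [HC Herr]].
  assert (Ha := a0_pos). assert (Hk := kap_pos). assert (HK1 := K1_pos).
  set (K := Kd C * (1 + 8 / kap) ^ 2 * (4 * K1) * (12 * gamma / V)).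
  set (T := Rmax (Rmax (4 * K1) (9 / 8 * kap)) (Rmax C K)).
  assert (T1 : 4 * K1 <= T) by (eapply Rle_trans; [apply Rmax_l | apply Rmax_l]).
  assert (T2 : 9 / 8 * kap <= T) by (eapply Rle_trans; [apply Rmax_r | apply Rmax_l]).
  assert (T3 : C <= T) by (eapply Rle_trans; [apply Rmax_l | apply Rmax_r]).
  assert (T4 : K <= T) by (eapply Rle_trans; [apply Rmax_r | apply Rmax_r]).
  assert (H14 : 0 < a0 / (14 * C)) by (apply Rdiv_lt_0_compat; lra).
  exists (Rmin 1 (Rmin e1 (a0 / (14 * C)))), T.
  split; [repeat apply Rmin_pos; lra|]. split; [lra|]. split; [apply Rmin_l|].
  intros i Hi x Hx.
  assert (M1 := Rmin_r 1 (Rmin e1 (a0 / (14 * C)))).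
  assert (M2 := Rmin_l e1 (a0 / (14 * C))). assert (M3 := Rmin_r e1 (a0 / (14 * C))).
  assert (Htail : forall x, 0 <= x -> tail i x) by (intros; apply Ht; lra).
  assert (Hs : eps i * C <= a0 / 14).
  { replace (a0 / 14) with (a0 / (14 * C) * C) by (field; lra).
    apply Rmult_le_compat_r; lra. }
  assert (He := eps_pos i). assert (HW := W_pos i Htail x Hx).
  assert (Hx4 := exp_pos (- (kap / 4) * x)).
  split; [now apply Htail|]. repeat split.
  - apply Rle_trans with (1 := W_decay C i Herr Htail Hs x Hx).
    apply Rmult_le_compat; try lra; [left; apply exp_pos|].
    apply exp_le. nra.
  - apply Rle_trans with (1 := P_bound C i Herr Htail Hs x Hx).
    apply Rmult_le_compat_r; lra.
  - apply Rle_trans with (1 := Herr i x (Htail x Hx)). apply Rmult_le_compat_r; lra.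
  - apply Rle_trans with (1 := W_KdV_bound C i HC Herr Htail Hs x Hx). fold K.
    apply Rmult_le_compat_r; [lra|]. apply Rmult_le_compat_l; lra.
Qed.

(** * Differential equation and decay of the KdV profile *)

Definition dv (x : R) : R := - dinv_KdV x * v x ^ 2.

Lemma v_derive (x : R) : is_derive v x (dv x).
Proof.
  assert (Hi := inv_KdV_pos x).
  apply is_derive_congr with (fun t => / inv_KdV t); [intros; now rewrite v_inv|].
  apply is_derive_eq with (- dinv_KdV x / inv_KdV x ^ 2).
  - apply is_derive_inv; [apply inv_KdV_derive | lra].
  - unfold dv. rewrite v_inv. field. lra.
Qed.

Lemma dinv_KdV_sqr (x : R) :
  dinv_KdV x ^ 2 = a0 * inv_KdV x ^ 2 - 2 / 3 * V ^ 2 * inv_KdV x.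
Proof.
  assert (HV := V_pos). assert (H := cosh_sqr_minus (kap / 2 * x)).
  unfold dinv_KdV, inv_KdV.
  replace ((V / (3 * gamma) * (kap * cosh (kap / 2 * x) * sinh (kap / 2 * x))) ^ 2)
    with ((V / (3 * gamma)) ^ 2 * (kap ^ 2 * cosh (kap / 2 * x) ^ 2
          * sinh (kap / 2 * x) ^ 2)) by ring.
  replace (sinh (kap / 2 * x) ^ 2) with (cosh (kap / 2 * x) ^ 2 - 1) by lra.
  rewrite kap_sqr. unfold a0. field. lra.
Qed.

Lemma dv_derive (x : R) : is_derive dv x (a0 * v x - V ^ 2 * v x ^ 2).
Proof.
  apply is_derive_eq with
    (- (a0 * inv_KdV x - V ^ 2 / 3) * v x ^ 2
     + - dinv_KdV x * (INR 2 * dv x * v x ^ 1)).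
  - apply (is_derive_mult (fun t => - dinv_KdV t) (fun t => v t ^ 2)).
    + apply (is_derive_opp dinv_KdV), dinv_KdV_derive.
    + apply (is_derive_pow v 2), v_derive.
    + intros; apply Rmult_comm.
  - assert (Hi := inv_KdV_pos x). unfold dv. rewrite v_inv.
    replace (- dinv_KdV x * (INR 2 * (- dinv_KdV x * (/ inv_KdV x) ^ 2) * (/ inv_KdV x) ^ 1))
      with (2 * dinv_KdV x ^ 2 * (/ inv_KdV x) ^ 3) by (simpl; ring).
    rewrite dinv_KdV_sqr. field. lra.
Qed.

Lemma dv_bound (x : R) : Rabs (dv x) <= kap * v x.
Proof.
  assert (Hi := inv_KdV_pos x). assert (Hk := kap_pos). assert (Hv := v_pos x).
  assert (HV := pow2_ge_0 V).
  assert (H : dinv_KdV x ^ 2 <= (kap * inv_KdV x) ^ 2).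
  { rewrite dinv_KdV_sqr.
    replace ((kap * inv_KdV x) ^ 2) with (kap ^ 2 * inv_KdV x ^ 2) by ring.
    rewrite kap_sqr.
    assert (0 <= V ^ 2 * inv_KdV x) by (apply Rmult_le_pos; lra). lra. }
  rewrite <- !Rsqr_pow2 in H. apply Rsqr_le_abs_0 in H.
  rewrite (Rabs_pos_eq (kap * inv_KdV x)) in H by (apply Rmult_le_pos; lra).
  unfold dv. rewrite Rabs_mult, Rabs_Ropp, (Rabs_pos_eq (v x ^ 2)) by apply pow2_ge_0.
  apply Rle_trans with (kap * inv_KdV x * v x ^ 2).
  - apply Rmult_le_compat_r; [apply pow2_ge_0 | trivial].
  - right. rewrite v_inv. field. lra.
Qed.

(** * Higher derivatives *)

(** For [alpha = kap / 2] this is the weight [exp (alpha * x / 2)] of the theorem, for [x >= 0]. *)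
Definition wt (x : R) : R := exp (kap / 4 * x).
Definition Delta (i : wave) (x : R) : R := (W i x - v x) / eps i.
Definition dDelta (i : wave) (x : R) : R := (P i x - dv x) / eps i.

Lemma wt_ge_1 (x : R) : 0 <= x -> 1 <= wt x.
Proof.
  intros Hx. unfold wt. rewrite <- exp_0. apply exp_le. assert (H := kap_pos). nra.
Qed.

Lemma wt_nonneg (x : R) : 0 <= x -> 0 <= wt x.
Proof. intros _. left. apply exp_pos. Qed.

Lemma wt_inv (x : R) : wt x * exp (- (kap / 4) * x) = 1.
Proof.
  unfold wt. rewrite <- exp_plus.
  replace (kap / 4 * x + - (kap / 4) * x) with 0 by ring. apply exp_0.
Qed.

Lemma Delta_derive (i : wave) (x : R) : is_derive (Delta i) x (dDelta i x).
Proof.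
  unfold Delta, dDelta.
  apply is_derive_congr with (fun t => / eps i * (W i t - v t));
    [intros; unfold Rdiv; ring|].
  apply is_derive_eq with (/ eps i * (P i x - dv x)); [|unfold Rdiv; ring].
  apply is_derive_scal, (is_derive_minus (W i) v); [apply W_derive | apply v_derive].
Qed.

Lemma dDelta_derive (i : wave) (x : R) :
  is_derive (dDelta i) x (a0 * Delta i x - V ^ 2 * (W i x + v x) * Delta i x + err i x).
Proof.
  assert (He := eps_pos i). unfold dDelta.
  apply is_derive_congr with (fun t => / eps i * (P i t - dv t));
    [intros; unfold Rdiv; ring|].
  apply is_derive_eq with (/ eps i *
    (a0 * W i x - V ^ 2 * W i x ^ 2 + eps i * err i x - (a0 * v x - V ^ 2 * v x ^ 2))).
  - apply is_derive_scal, (is_derive_minus (P i) dv); [apply P_derive_err | apply dv_derive].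
  - unfold Delta. field. lra.
Qed.

Section AllDerivatives.

Context (e1 C : R) (He1 : e1 <= 1) (HC : 0 < C)
  (Hprofile : forall i, eps i < e1 -> forall x, 0 <= x ->
    tail i x /\ W i x <= C * exp (- (kap / 4) * x) /\
    Rabs (P i x) <= C * W i x /\ Rabs (err i x) <= C * W i x /\
    Rabs (W i x - v x) <= eps i * C * exp (- (kap / 4) * x)).

Local Notation small := (fun i : wave => eps i < e1).
Local Notation bdd := (bounded_derivs small).
Local Notation one := (fun _ : R => 1).

Lemma bdd_one (k : nat) (F : wave -> R -> R) : bdd wt k F -> bdd one k F.
Proof.
  apply bounded_derivs_weight_le. intros x Hx. assert (H := wt_ge_1 x Hx). lra.
Qed.

Lemma bdd_W_multiple (F : wave -> R -> R) (K : R) :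
  0 <= K -> (forall i x, eps i < e1 -> 0 <= x -> Rabs (F i x) <= K * W i x) ->
  bdd wt 0 F.
Proof.
  intros HK H. split; trivial. apply bounded_on_le with (K * C). intros i x [Hi Hx].
  rewrite Rabs_mult, Rabs_pos_eq by now apply wt_nonneg.
  apply Rle_trans with (wt x * (K * (C * exp (- (kap / 4) * x)))).
  - apply Rmult_le_compat_l; [now apply wt_nonneg|].
    apply Rle_trans with (1 := H i x Hi Hx). apply Rmult_le_compat_l; trivial.
    now apply Hprofile.
  - right. assert (E := wt_inv x).
    replace (wt x * (K * (C * exp (- (kap / 4) * x))))
      with (K * C * (wt x * exp (- (kap / 4) * x))) by ring.
    rewrite E. ring.
Qed.

Lemma bdd_param (k : nat) (f : wave -> R) (a b : R) :
  (forall i, eps i <= 1 -> a <= f i <= b) -> bdd one k (fun i _ => f i).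
Proof.
  intros H. apply bounded_derivs_param. exists (Rmax (Rabs a) (Rabs b)).
  intros i Hi. specialize (H i ltac:(lra)).
  assert (X1 := Rmax_l (Rabs a) (Rabs b)). assert (X2 := Rmax_r (Rabs a) (Rabs b)).
  assert (X3 := Rle_abs (- a)). assert (X4 := Rle_abs b). rewrite Rabs_Ropp in X3.
  apply Rabs_le. lra.
Qed.

Lemma bdd_eps (k : nat) : bdd one k (fun i _ => eps i).
Proof. apply bdd_param with 0 1. intros i Hi. assert (H := eps_pos i). lra. Qed.

Lemma bdd_dd (k : nat) : bdd one k (fun i _ => dd i).
Proof. apply bdd_param with (1 := dd_bounds). Qed.

Lemma bdd_c2 (k : nat) : bdd one k (fun i _ => c2 i).
Proof. apply bdd_param with (1 := c2_bounds). Qed.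

Ltac bounded_tac :=
  repeat first
    [ assumption | apply bdd_eps | apply bdd_dd | apply bdd_c2
    | apply bounded_derivs_const | apply bounded_derivs_plus
    | apply bounded_derivs_minus; [exact wt_nonneg | |]
    | apply bounded_derivs_minus; [intros; lra | |]
    | apply bounded_derivs_opp; [exact wt_nonneg |]
    | apply bounded_derivs_opp; [intros; lra |]
    | apply bounded_derivs_pow | apply bounded_derivs_mult_1 ].

(** [tail] speaks of the half-line only, but [bounded_derivs] demands derivatives on the whole line;
    evenness of the density carries the bound over. *)
Lemma h_neq_0 (i : wave) (x : R) : eps i < e1 -> h i x <> 0.
Proof.
  intros Hi. assert (E : h i x = h i (Rabs x)).
  { unfold Rabs. destruct (Rcase_abs x); trivial. unfold h, I0. now rewrite dens_even. }
  rewrite E. assert (H := h_bounds i (Rabs x)).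
  specialize (H (proj1 (Hprofile i Hi (Rabs x) (Rabs_pos x)))). lra.
Qed.

Lemma dM_P (i : wave) (x : R) : eps i < e1 -> dM i x = P i x * J i x.
Proof. intros Hi. assert (H := h_neq_0 i x Hi). rewrite P_eq. unfold J. field. trivial. Qed.

Lemma J_derive (i : wave) (x : R) : eps i < e1 ->
  is_derive (J i) x
    (P i x * J i x * (eps i * I0 i x ^ 2 * J i x ^ 2 * (c2 i * 3 * I0 i x ^ 2 - sigma))).
Proof.
  intros Hi. assert (Hh := h_neq_0 i x Hi). rewrite <- dM_P by trivial.
  set (D := - eps i * dM i x * I0 i x ^ 2).
  apply is_derive_eq with (- (c2 i * (INR 3 * D * I0 i x ^ 2) - sigma * D) / h i x ^ 2).
  - apply (is_derive_inv (h i)); trivial.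
    apply (is_derive_minus (fun t => c2 i * I0 i t ^ 3) (fun t => sigma * I0 i t));
      apply is_derive_scal; [apply (is_derive_pow (I0 i) 3)|]; apply I0_derive.
  - unfold D, J. simpl. field. trivial.
Qed.

(** The eight quantities are treated together because the derivative of each is a polynomial in
    them, so order [k] for all gives order [k + 1] for all. Derivatives of the weighted quantities
    keep a decaying factor in every term. [I0] and [J] do not decay and carry weight 1; [M] is
    recovered as [W - eps Y]. *)
Lemma state_bdd (k : nat) :
  (bdd wt k W /\ bdd wt k P /\ bdd wt k Y /\ bdd wt k M) /\
  (bdd wt k E1 /\ bdd wt k E2 /\ bdd one k I0 /\ bdd one k J).
Proof.
  assert (ZW : bdd wt 0 W).
  { apply bdd_W_multiple with 1; [lra|]. intros i x Hi Hx.
    destruct (Hprofile i Hi x Hx) as [Ht _]. assert (H := W_bounds i x Ht).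
    rewrite Rabs_pos_eq; lra. }
  assert (ZP : bdd wt 0 P).
  { apply bdd_W_multiple with C; [lra|]. intros i x Hi Hx. now apply Hprofile. }
  assert (ZY : bdd wt 0 Y).
  { apply bdd_W_multiple with (2 * Q1); [assert (H := Q1_pos); lra|]. intros i x Hi Hx.
    now apply Y_bound, Hprofile. }
  assert (ZE1 : bdd wt 0 E1).
  { apply bdd_W_multiple with (exp (2 * K1)); [left; apply exp_pos|]. intros i x Hi Hx.
    now apply E1_bound, Hprofile. }
  assert (ZE2 : bdd wt 0 E2).
  { apply bdd_W_multiple with (2 * K1 * exp (2 * K1)).
    - assert (H := exp_pos (2 * K1)). assert (HK := K1_pos). nra.
    - intros i x Hi Hx. now apply E2_bound, Hprofile. }
  assert (ZI : bdd one 0 I0).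
  { split; trivial. apply bounded_on_le with 1. intros i x _.
    assert (H := I0_bounds i x). rewrite Rmult_1_l, Rabs_pos_eq; lra. }
  assert (ZJ : bdd one 0 J).
  { split; trivial. apply bounded_on_le with 2. intros i x [Hi Hx].
    assert (H := J_bounds i x (proj1 (Hprofile i Hi x Hx))).
    rewrite Rmult_1_l, Rabs_pos_eq; lra. }
  assert (M_of : forall k, bdd wt k W -> bdd wt k Y -> bdd wt k M).
  { intros j HW HY. apply bounded_derivs_ext with (fun i x => W i x - eps i * Y i x).
    - intros i Hi x. assert (He := eps_pos i). unfold Y. field. lra.
    - bounded_tac. apply bounded_derivs_mult_r; [exact wt_nonneg | apply bdd_eps | trivial]. }
  induction k as [|k IH].
  - split; [split; [|split; [|split]] | split; [|split; [|split]]]; auto.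
  - destruct IH as [(HW & HP & HY & HM) (HE1 & HE2 & HI & HJ)].
    assert (HM1 := bdd_one _ _ HM). assert (HP1 := bdd_one _ _ HP).
    assert (HE11 := bdd_one _ _ HE1).
    assert (SW : bdd wt (S k) W).
    { apply bounded_derivs_S with P; trivial. intros; apply W_derive. }
    assert (SY : bdd wt (S k) Y).
    { apply bounded_derivs_S with (fun i x => P i x * (J i x * q i x)); trivial.
      - intros i Hi x. apply is_derive_eq with (1 := Y_derive i x).
        rewrite dM_P by trivial. ring.
      - apply bounded_derivs_mult_l; [exact wt_nonneg | trivial |].
        unfold q, r. bounded_tac. }
    split; [split; [|split; [|split]] | split; [|split; [|split]]]; trivial.
    + apply bounded_derivs_S with (fun i x => E2 i x + Y i x); trivial.
      * intros; apply P_derive.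
      * bounded_tac.
    + now apply M_of.
    + apply bounded_derivs_S with (fun i x => P i x * (1 + eps i * E1 i x)); trivial.
      * intros; apply E1_derive.
      * apply bounded_derivs_mult_l; [exact wt_nonneg | trivial | bounded_tac].
    + apply bounded_derivs_S with (fun i x => P i x * E1 i x); trivial.
      * intros; apply E2_derive.
      * apply bounded_derivs_mult_l; [exact wt_nonneg | trivial | bounded_tac].
    + apply bounded_derivs_S with (fun i x => - eps i * (P i x * J i x) * I0 i x ^ 2); trivial.
      * intros i Hi x. rewrite <- dM_P by trivial. apply I0_derive.
      * bounded_tac.
    + apply bounded_derivs_S with (fun i x => P i x * J i x *
        (eps i * I0 i x ^ 2 * J i x ^ 2 * (c2 i * 3 * I0 i x ^ 2 - sigma))); trivial.
      * intros i Hi x. now apply J_derive.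
      * bounded_tac.
Qed.

Lemma err_bdd (k : nat) : bdd wt k err.
Proof.
  assert (Z : bdd wt 0 err).
  { apply bdd_W_multiple with C; [lra|]. intros i x Hi Hx. now apply Hprofile. }
  destruct k as [|k]; trivial.
  destruct (state_bdd k) as [(HW & HP & HY & HM) (HE1 & HE2 & HI & HJ)].
  assert (HM1 := bdd_one _ _ HM). assert (HY1 := bdd_one _ _ HY).
  assert (HE21 := bdd_one _ _ HE2).
  apply bounded_derivs_S with (fun i x => P i x * rho i x); trivial.
  - intros i Hi x. apply err_derive. now apply h_neq_0.
  - apply bounded_derivs_mult_l; [exact wt_nonneg | trivial |].
    unfold rho, q, r. bounded_tac.
Qed.

Lemma v_bdd (k : nat) : bdd wt k (fun _ => v) /\ bdd wt k (fun _ => dv).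
Proof.
  assert (HV := V_pos). assert (Hk := kap_pos).
  assert (Z : forall x, 0 <= x -> wt x * v x <= 12 * gamma / V).
  { intros x Hx. apply Rle_trans with (wt x * (12 * gamma / V * exp (- (kap / 4) * x))).
    - apply Rmult_le_compat_l; [now apply wt_nonneg|].
      apply Rle_trans with (1 := v_decay x). apply Rmult_le_compat_l.
      + left. apply Rdiv_lt_0_compat; lra.
      + apply exp_le. nra.
    - right. replace (wt x * (12 * gamma / V * exp (- (kap / 4) * x)))
        with (12 * gamma / V * (wt x * exp (- (kap / 4) * x))) by ring.
      rewrite wt_inv. ring. }
  assert (Zv : bdd wt 0 (fun _ => v)).
  { split; trivial. apply bounded_on_le with (12 * gamma / V). intros i x [_ Hx].
    rewrite Rabs_pos_eq; [now apply Z|].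
    apply Rmult_le_pos; [now apply wt_nonneg | left; apply v_pos]. }
  assert (Zdv : bdd wt 0 (fun _ => dv)).
  { split; trivial. apply bounded_on_le with (kap * (12 * gamma / V)). intros i x [_ Hx].
    rewrite Rabs_mult, (Rabs_pos_eq (wt x)) by now apply wt_nonneg.
    apply Rle_trans with (kap * (wt x * v x)).
    - replace (kap * (wt x * v x)) with (wt x * (kap * v x)) by ring.
      apply Rmult_le_compat_l; [now apply wt_nonneg | apply dv_bound].
    - apply Rmult_le_compat_l; [lra | now apply Z]. }
  induction k as [|k [IH1 IH2]]; split; trivial.
  - apply bounded_derivs_S with (fun _ => dv); trivial. intros; apply v_derive.
  - apply bounded_derivs_S with (fun _ x => v x * (a0 - V ^ 2 * v x)); trivial.
    + intros i _ x. apply is_derive_eq with (1 := dv_derive x). ring.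
    + assert (H1 := bdd_one _ _ IH1).
      apply bounded_derivs_mult_l; [exact wt_nonneg | trivial | bounded_tac].
Qed.

Lemma ddDelta_bdd (k : nat) : bdd wt k Delta ->
  bdd wt k (fun i x => a0 * Delta i x - V ^ 2 * (W i x + v x) * Delta i x + err i x).
Proof.
  intros HD. destruct (state_bdd k) as [(HW & _) _]. destruct (v_bdd k) as [Hv _].
  assert (HW1 := bdd_one _ _ HW). assert (Hv1 := bdd_one _ _ Hv).
  assert (Herr := err_bdd k).
  apply bounded_derivs_ext with
    (fun i x => Delta i x * (a0 - V ^ 2 * (W i x + v x)) + err i x); [intros; ring|].
  bounded_tac. apply bounded_derivs_mult_l; [exact wt_nonneg | trivial | bounded_tac].
Qed.

(** The comparison of profiles controls [W - v] but says nothing of [P - dv]. The missing bound of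
    order zero on [dDelta] is interpolated between [Delta] and its second derivative; afterwards the
    equation of [Delta] closes the induction. *)
Lemma Delta_bdd (k : nat) : bdd wt k Delta /\ bdd wt k dDelta.
Proof.
  assert (Hk := kap_pos).
  assert (B : forall i x, eps i < e1 -> 0 <= x ->
    Rabs (Delta i x) <= C * exp (- (kap / 4) * x)).
  { intros i x Hi Hx. assert (He := eps_pos i).
    destruct (Hprofile i Hi x Hx) as (_ & _ & _ & _ & H).
    unfold Delta. rewrite Rabs_div, (Rabs_pos_eq (eps i)) by lra.
    apply Rmult_le_reg_l with (eps i); trivial.
    replace (eps i * (Rabs (W i x - v x) / eps i)) with (Rabs (W i x - v x)) by (field; lra).
    lra. }
  assert (Z : bdd wt 0 Delta).
  { split; trivial. apply bounded_on_le with C. intros i x [Hi Hx].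
    rewrite Rabs_mult, (Rabs_pos_eq (wt x)) by now apply wt_nonneg.
    apply Rle_trans with (wt x * (C * exp (- (kap / 4) * x))).
    - apply Rmult_le_compat_l; [now apply wt_nonneg | now apply B].
    - right. replace (wt x * (C * exp (- (kap / 4) * x)))
        with (C * (wt x * exp (- (kap / 4) * x))) by ring. rewrite wt_inv. ring. }
  assert (Zd : bdd wt 0 dDelta).
  { split; trivial. destruct (ddDelta_bdd 0 Z) as [[A [HA H]] _].
    apply bounded_on_le with (2 * C + A). intros i x [Hi Hx].
    rewrite Rabs_mult, (Rabs_pos_eq (wt x)) by now apply wt_nonneg.
    assert (Hw := wt_inv x). assert (Hwp := wt_ge_1 x Hx).
    assert (Hdec : forall t, x <= t -> exp (- (kap / 4) * t) <= exp (- (kap / 4) * x)).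
    { intros t Ht. apply exp_le. nra. }
    apply Rle_trans with (wt x * (2 * (C * exp (- (kap / 4) * x))
                                  + A * exp (- (kap / 4) * x))).
    - apply Rmult_le_compat_l; [lra|].
      apply (derive_interpolation (Delta i) (dDelta i) (fun x =>
        a0 * Delta i x - V ^ 2 * (W i x + v x) * Delta i x + err i x)).
      + intros; apply Delta_derive.
      + intros; apply dDelta_derive.
      + intros t Ht. apply Rle_trans with (1 := B i t Hi ltac:(lra)).
        apply Rmult_le_compat_l; [lra | auto].
      + intros t Ht. assert (Ht0 : 0 <= t) by lra.
        specialize (H i t (conj Hi Ht0)). cbv beta in H.
        rewrite Rabs_mult, (Rabs_pos_eq (wt t)) in H by now apply wt_nonneg.
        apply Rle_trans with (A * exp (- (kap / 4) * t)).
        * apply Rmult_le_reg_l with (wt t); [apply exp_pos|].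
          replace (wt t * (A * exp (- (kap / 4) * t)))
            with (A * (wt t * exp (- (kap / 4) * t))) by ring.
          rewrite wt_inv. lra.
        * apply Rmult_le_compat_l; [lra | auto].
    - right. replace (wt x * (2 * (C * exp (- (kap / 4) * x)) + A * exp (- (kap / 4) * x)))
        with ((2 * C + A) * (wt x * exp (- (kap / 4) * x))) by ring.
      rewrite Hw. ring. }
  induction k as [|k [IH1 IH2]]; split; trivial.
  - apply bounded_derivs_S with dDelta; trivial. intros; apply Delta_derive.
  - apply bounded_derivs_S with (2 := fun i _ => dDelta_derive i); trivial.
    now apply ddDelta_bdd.
Qed.

(** The bound on [G] lives on the half-line. Evenness of [F] passes to [G] on dividing by [eps^2],
    and gives the estimate at [Rabs x] for every [x]. *)
Lemma remainder_bound (F : wave -> R -> R) (G : wave -> R -> R) (k : nat) :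
  bdd wt k G -> (forall i x, eps i < e1 -> F i x = eps i ^ 2 * G i x) ->
  (forall i x, F i (- x) = F i x) ->
  exists K, 0 < K /\ forall i x, eps i < e1 ->
    exp (kap / 2 * Rabs x / 2) * Rabs (Derive_n (F i) k x) <= K * eps i ^ 2.
Proof.
  intros HG E Ev. destruct (bounded_derivs_Derive_n _ _ _ _ HG) as [K [HK H]].
  exists K. split; trivial. intros i x Hi.
  assert (He := eps_pos i).
  assert (EvG : forall t, G i (- t) = G i t).
  { intros t. apply Rmult_eq_reg_l with (eps i ^ 2); [|apply pow_nonzero; lra].
    rewrite <- !E by trivial. apply Ev. }
  rewrite (Derive_n_ext (F i) (fun t => eps i ^ 2 * G i t)) by (intros; now apply E).
  rewrite Derive_n_scal_l, Rabs_mult, (Rabs_pos_eq (eps i ^ 2)) by apply pow2_ge_0.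
  rewrite (bounded_derivs_even _ _ _ _ i HG Hi EvG x).
  specialize (H i (Rabs x) (conj Hi (Rabs_pos x))). cbv beta in H.
  rewrite Rabs_mult, (Rabs_pos_eq (wt (Rabs x))) in H by (apply wt_nonneg, Rabs_pos).
  replace (kap / 2 * Rabs x / 2) with (kap / 4 * Rabs x) by field. fold (wt (Rabs x)).
  replace (wt (Rabs x) * (eps i ^ 2 * Rabs (Derive_n (G i) k (Rabs x))))
    with (wt (Rabs x) * Rabs (Derive_n (G i) k (Rabs x)) * eps i ^ 2) by ring.
  apply Rmult_le_compat_r; [apply pow2_ge_0 | trivial].
Qed.

Lemma v_even (x : R) : v (- x) = v x.
Proof.
  unfold n_KdV, sech, cosh.
  replace (sqrt (V * gamma / 2) * - x) with (- (sqrt (V * gamma / 2) * x)) by ring.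
  rewrite Ropp_involutive, (Rplus_comm (exp (- _))). trivial.
Qed.

Lemma remainders_bound (k : nat) :
  exists K, 0 < K /\ forall (i : wave) (x : R), eps i < e1 ->
    exp (kap / 2 * Rabs x / 2) * Rabs (Derive_n (n_R sigma gamma (eps i) (dens i)) k x)
      <= K * eps i ^ 2 /\
    exp (kap / 2 * Rabs x / 2) * Rabs (Derive_n (u_R sigma gamma (eps i) (vel i)) k x)
      <= K * eps i ^ 2 /\
    exp (kap / 2 * Rabs x / 2) * Rabs (Derive_n (phi_R sigma gamma (eps i) (pot i)) k x)
      <= K * eps i ^ 2.
Proof.
  destruct (state_bdd k) as [(HW & HP & HY & HM) (_ & _ & HI & _)].
  destruct (Delta_bdd k) as [HD _]. assert (HM1 := bdd_one _ _ HM).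
  assert (HDY : bdd wt k (fun i x => Delta i x - Y i x)) by bounded_tac.
  destruct (remainder_bound (fun i => n_R sigma gamma (eps i) (dens i))
    (fun i x => Delta i x - Y i x) k) as [Kn [HKn Hn]]; trivial.
  { intros i x _. assert (He := eps_pos i). unfold n_R, Delta, Y, W, M. field. lra. }
  { intros i x. unfold n_R. now rewrite dens_even, v_even. }
  (* With [c = V + gamma eps], [u = c eps M I0] and [I0 = 1 - eps M I0]. The part of order [eps]
     left after subtracting [eps V v] is [V (M - v)], which equals [eps V (Delta - Y)]. *)
  destruct (remainder_bound (fun i => u_R sigma gamma (eps i) (vel i))
    (fun i x => M i x * (gamma - (V + gamma * eps i) * (M i x * I0 i x))
                + V * (Delta i x - Y i x)) k) as [Ku [HKu Hu]].
  { apply bounded_derivs_plus.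
    - apply bounded_derivs_mult_l; [exact wt_nonneg | trivial | bounded_tac].
    - apply bounded_derivs_mult_r; [exact wt_nonneg | bounded_tac | trivial]. }
  { intros i x _. assert (He := eps_pos i). assert (Hg := dens_gt_1 i x).
    unfold u_R. rewrite vel_eq. unfold Delta, Y, W, M, I0. field. lra. }
  { intros i x. unfold u_R. now rewrite !vel_eq, dens_even, v_even. }
  destruct (remainder_bound (fun i => phi_R sigma gamma (eps i) (pot i)) Delta k)
    as [Kp [HKp Hp]]; trivial.
  { intros i x _. assert (He := eps_pos i). unfold phi_R, Delta, W. field. lra. }
  { intros i x. unfold phi_R. now rewrite pot_even, v_even. }
  exists (Kn + Ku + Kp). split; [lra|]. intros i x Hi.
  specialize (Hn i x Hi). specialize (Hu i x Hi). specialize (Hp i x Hi).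
  assert (H2 := pow2_ge_0 (eps i)).
  assert (X1 := Rmult_le_pos _ _ (Rlt_le _ _ HKn) H2).
  assert (X2 := Rmult_le_pos _ _ (Rlt_le _ _ HKu) H2).
  assert (X3 := Rmult_le_pos _ _ (Rlt_le _ _ HKp) H2).
  lra.
Qed.

End AllDerivatives.

End SolitaryWaves.

Theorem theorem1p2 (sigma gamma : R) (Hsigma : 0 <= sigma) (Hgamma : 0 < gamma) :
  exists eps1 alpha : R, 0 < eps1 /\ 0 < alpha /\
  exists C : nat -> R, (forall k, 0 < C k) /\
  forall eps : R, 0 < eps < eps1 ->
  forall n u phi : R -> R, solitary_wave sigma gamma eps n u phi ->
  forall (k : nat) (xi : R),
    exp (alpha * Rabs xi / 2) * Rabs (Derive_n (n_R sigma gamma eps n) k xi) <= C k * eps ^ 2 /\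
    exp (alpha * Rabs xi / 2) * Rabs (Derive_n (u_R sigma gamma eps u) k xi) <= C k * eps ^ 2 /\
    exp (alpha * Rabs xi / 2) * Rabs (Derive_n (phi_R sigma gamma eps phi) k xi) <= C k * eps ^ 2.
Proof.
  destruct (profile_bounds sigma gamma Hsigma Hgamma) as (e1 & A & He1 & HA & Hle & Hprofile).
  (* [e1] is fixed before [k] appears, since only the bounds of order zero restrict [eps]; choice
     then collects the constants of all orders into one sequence. *)
  destruct (functional_choice _
    (remainders_bound sigma gamma Hsigma Hgamma e1 A Hle HA Hprofile)) as [C HC].
  exists e1, (kap sigma gamma / 2). split; trivial. split.
  { assert (H := kap_pos sigma gamma Hsigma Hgamma). lra. }
  exists C. split; [intros k; apply HC|].
  intros eps [He He'] n u phi Hs k xi.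
  exact (proj2 (HC k) (Wave sigma gamma eps n u phi He Hs) xi He').
Qed.
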